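(* Let $\mathscr{T}$ be an essentially small tensor-triangulated category acting on an essentially small triangulated category $\mathscr{K}$, and let $\mathscr{T}\ltimes\mathscr{K}$ be the trivial extension of $\mathscr{T}$ by $\mathscr{K}$. Then there is a homeomorphism of homological spectra $\mathrm{Spc}^{\mathrm{h}}(\mathscr{T}\ltimes\mathscr{K})\cong\mathrm{Spc}^{\mathrm{h}}(\mathscr{T})$.
   Context: A tensor-triangulated category $(\mathscr{T},\otimes,1)$ is a triangulated category with a symmetric monoidal structure whose tensor product is a triangulated functor in each variable. An action of $\mathscr{T}$ on a triangulated category $\mathscr{K}$ is a functor $-\ast-\colon\mathscr{T}\times\mathscr{K}\to\mathscr{K}$, triangulated in both variables, that is associative and unital: there are natural isomorphisms $(X\otimes Y)\ast A\cong X\ast(Y\ast A)$ and $1\ast A\cong A$ for $X,Y\in\mathscr{T}$, $A\in\mathscr{K}$ (compatible in the usual sense). The trivial extension $\mathscr{T}\ltimes\mathscr{K}$ is the product triangulated category $\mathscr{T}\times\mathscr{K}$ with the tensor product $(X,A)\otimes(Y,B)=(X\otimes Y,\,X\ast B\oplus Y\ast A)$ on objects, $(f_1,g_1)\otimes(f_2,g_2)=(f_1\otimes f_2,\,f_1\ast g_2\oplus f_2\ast g_1)$ on morphisms, and unit $(1,0)$; it is a tensor-triangulated category. For an essentially small tensor-triangulated category $\mathscr{T}$, $\mathrm{Mod}\,\mathscr{T}$ is the abelian category of additive functors $\mathscr{T}^{\mathrm{op}}\to\mathrm{Ab}$, and $\mathrm{mod}\,\mathscr{T}$ its abelian subcategory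 of finitely presented objects. The Yoneda embedding is $X\mapsto\widehat{X}=\mathrm{Hom}_{\mathscr{T}}(-,X)$. $\mathrm{Mod}\,\mathscr{T}$ carries the symmetric tensor product (Day convolution) which is right exact and colimit-preserving in each variable and satisfies $\widehat{X}\otimes\widehat{Y}\cong\widehat{X\otimes Y}$; it restricts to $\mathrm{mod}\,\mathscr{T}$. A Serre subcategory of an abelian category is a full subcategory closed under subobjects, quotients and extensions; a Serre tensor-ideal $\mathscr{B}$ of $\mathrm{mod}\,\mathscr{T}$ is a Serre subcategory such that $M\otimes B\in\mathscr{B}$ for all $M\in\mathrm{mod}\,\mathscr{T}$, $B\in\mathscr{B}$. The homological spectrum $\mathrm{Spc}^{\mathrm{h}}(\mathscr{T})$ is the set of proper maximal Serre tensor-ideals of $\mathrm{mod}\,\mathscr{T}$, with the topology having as a basis of closed subsets the sets $\mathrm{supp}^{\mathrm{h}}(X)=\{\mathscr{B}\mid\widehat{X}\notin\mathscr{B}\}$ for $X\in\mathscr{T}$. *)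

(* Defs.v *)
From HB Require Import structures.
From mathcomp Require Import all_boot all_order all_algebra.
From mathcomp Require Import boolp classical_sets.
From mathcomp Require Import topology_structure.

Set Implicit Arguments.
Unset Strict Implicit.
Unset Printing Implicit Defensive.

Import GRing.Theory.
Local Open Scope ring_scope.

(* Abelian groups.  MathComp's [zmodType] cannot be used as the target of the
   functor categories below, because the universe of the type [zmodType] lies
   above the universe of [classical_sets.set], hence above that of the carrier
   of any library topological space.  [abGrp] is universe-small, and every
   [abGrp] is canonically a [zmodType]. *)
Record abGrp := AbGrp {
  ab_sort :> Type;
  ab_zero : ab_sort;
  ab_opp : ab_sort -> ab_sort;
  ab_add : ab_sort -> ab_sort -> ab_sort;
  ab_addA : associative ab_add;
  ab_addC : commutative ab_add;
  ab_add0 : left_id ab_zero ab_add;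
  ab_addN : left_inverse ab_zero ab_opp ab_add }.

HB.instance Definition _ (A : abGrp) := gen_eqMixin A.
HB.instance Definition _ (A : abGrp) := gen_choiceMixin A.
HB.instance Definition _ (A : abGrp) :=
  GRing.isZmodule.Build A (@ab_addA A) (@ab_addC A) (@ab_add0 A) (@ab_addN A).

Lemma prodAb_addA (A B : abGrp) :
  associative (fun x y : A * B => (x.1 + y.1, x.2 + y.2)).
Proof. by move=> x y z /=; rewrite !addrA. Qed.
Lemma prodAb_addC (A B : abGrp) :
  commutative (fun x y : A * B => (x.1 + y.1, x.2 + y.2)).
Proof. by move=> x y; rewrite (addrC x.1) (addrC x.2). Qed.
Lemma prodAb_add0 (A B : abGrp) :
  left_id (0, 0) (fun x y : A * B => (x.1 + y.1, x.2 + y.2)).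
Proof. by case=> x y /=; rewrite !add0r. Qed.
Lemma prodAb_addN (A B : abGrp) :
  left_inverse (0, 0) (fun x : A * B => (- x.1, - x.2))
    (fun x y : A * B => (x.1 + y.1, x.2 + y.2)).
Proof. by case=> x y /=; rewrite !addNr. Qed.

Definition prodAb (A B : abGrp) : abGrp :=
  AbGrp (@prodAb_addA A B) (@prodAb_addC A B) (@prodAb_add0 A B)
    (@prodAb_addN A B).

(* Additive categories, with a chosen zero object and chosen biproducts. *)
Record addCat := AddCat {
  ob :> Type;
  mor : ob -> ob -> abGrp;
  idm : forall X, mor X X;
  mcomp : forall X Y Z, mor Y Z -> mor X Y -> mor X Z;
  mcomp1m : forall X Y (f : mor X Y), mcomp (idm Y) f = f;
  mcompm1 : forall X Y (f : mor X Y), mcomp f (idm X) = f;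
  mcompA : forall X Y Z W (h : mor Z W) (g : mor Y Z) (f : mor X Y),
    mcomp h (mcomp g f) = mcomp (mcomp h g) f;
  mcompDl : forall X Y Z (g g' : mor Y Z) (f : mor X Y),
    mcomp (g + g') f = mcomp g f + mcomp g' f;
  mcompDr : forall X Y Z (g : mor Y Z) (f f' : mor X Y),
    mcomp g (f + f') = mcomp g f + mcomp g f';
  zob : ob;
  zobP : idm zob = 0;
  bip : ob -> ob -> ob;
  in1 : forall X Y, mor X (bip X Y);
  in2 : forall X Y, mor Y (bip X Y);
  pr1 : forall X Y, mor (bip X Y) X;
  pr2 : forall X Y, mor (bip X Y) Y;
  pr1in1 : forall X Y, mcomp (pr1 X Y) (in1 X Y) = idm X;
  pr2in2 : forall X Y, mcomp (pr2 X Y) (in2 X Y) = idm Y;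
  pr1in2 : forall X Y, mcomp (pr1 X Y) (in2 X Y) = 0;
  pr2in1 : forall X Y, mcomp (pr2 X Y) (in1 X Y) = 0;
  bip_id : forall X Y,
    mcomp (in1 X Y) (pr1 X Y) + mcomp (in2 X Y) (pr2 X Y) = idm (bip X Y) }.

Declare Scope cat_scope.
Delimit Scope cat_scope with cat.
Local Open Scope cat_scope.
Notation "g ∘ f" := (mcomp g f) (at level 40, left associativity) : cat_scope.
Notation "X ⊕ Y" := (bip X Y) (at level 50, left associativity) : cat_scope.
Arguments in1 {a X Y}.
Arguments in2 {a X Y}.
Arguments pr1 {a X Y}.
Arguments pr2 {a X Y}.

Definition bipm (C : addCat) (X X' Y Y' : C) (f : mor X X') (g : mor Y Y') :
    mor (X ⊕ Y) (X' ⊕ Y') :=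
  in1 ∘ f ∘ pr1 + in2 ∘ g ∘ pr2.

Record isom (C : addCat) (X Y : C) := Isom {
  fwd :> mor X Y;
  bwd : mor Y X;
  bwdK : bwd ∘ fwd = idm X;
  fwdK : fwd ∘ bwd = idm Y }.

(* Additive functors; a triangulated functor is in particular additive. *)
Record functor (C D : addCat) := Functor {
  fob :> C -> D;
  fmor : forall X Y : C, mor X Y -> mor (fob X) (fob Y);
  fmor1 : forall X, fmor (idm X) = idm (fob X);
  fmorC : forall X Y Z (g : mor Y Z) (f : mor X Y),
    fmor (g ∘ f) = fmor g ∘ fmor f;
  fmorD : forall X Y (f g : mor X Y), fmor (f + g) = fmor f + fmor g }.

Program Definition idF (C : addCat) : functor C C :=
  @Functor C C id (fun _ _ f => f) _ _ _.
Next Obligation. by []. Qed.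
Next Obligation. by []. Qed.
Next Obligation. by []. Qed.

Program Definition compF (C D E : addCat) (G : functor D E) (F : functor C D) :
    functor C E :=
  @Functor C E (fun X => G (F X)) (fun _ _ f => fmor G (fmor F f)) _ _ _.
Next Obligation. by move=> * /=; rewrite !fmor1. Qed.
Next Obligation. by move=> * /=; rewrite !fmorC. Qed.
Next Obligation. by move=> * /=; rewrite !fmorD. Qed.

Definition naturally_isomorphic (C D : addCat) (F G : functor C D) : Prop :=
  exists eta : forall X, isom (F X) (G X),
  forall X Y (f : mor X Y), fmor G f ∘ eta X = eta Y ∘ fmor F f.

Definition is_equivalence (C D : addCat) (F : functor C D) : Prop :=
  exists G : functor D C, naturally_isomorphic (compF G F) (idF C) /\
    naturally_isomorphic (compF F G) (idF D).

(* Triangulated categories, in the sense of Verdier; [TR4] is the octahedral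
   axiom. *)
Record triCat := TriCat {
  tri_cat :> addCat;
  susp : functor tri_cat tri_cat;
  susp_equiv : is_equivalence susp;
  dist : forall X Y Z : tri_cat,
    mor X Y -> mor Y Z -> mor Z (susp X) -> Prop;
  TR0 : forall (X Y Z X' Y' Z' : tri_cat)
      (f : mor X Y) (g : mor Y Z) (h : mor Z (susp X))
      (f' : mor X' Y') (g' : mor Y' Z') (h' : mor Z' (susp X'))
      (a : isom X X') (b : isom Y Y') (c : isom Z Z'),
    b ∘ f = f' ∘ a -> c ∘ g = g' ∘ b -> fmor susp a ∘ h = h' ∘ c ->
    dist f g h -> dist f' g' h';
  TR1_id : forall X, dist (idm X) (0 : mor X (zob _)) 0;
  TR1_cone : forall (X Y : tri_cat) (f : mor X Y),
    exists Z (g : mor Y Z) (h : mor Z (susp X)), dist f g h;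
  TR2 : forall (X Y Z : tri_cat)
      (f : mor X Y) (g : mor Y Z) (h : mor Z (susp X)),
    dist f g h <-> dist g h (- fmor susp f);
  TR3 : forall (X Y Z X' Y' Z' : tri_cat)
      (f : mor X Y) (g : mor Y Z) (h : mor Z (susp X))
      (f' : mor X' Y') (g' : mor Y' Z') (h' : mor Z' (susp X'))
      (a : mor X X') (b : mor Y Y'),
    dist f g h -> dist f' g' h' -> b ∘ f = f' ∘ a ->
    exists c : mor Z Z', c ∘ g = g' ∘ b /\ fmor susp a ∘ h = h' ∘ c;
  TR4 : forall (X Y Z U V W : tri_cat) (f : mor X Y) (g : mor Y Z)
      (i : mor Y U) (j : mor U (susp X))
      (k : mor Z V) (l : mor V (susp Y))
      (m : mor Z W) (n : mor W (susp X)),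
    dist f i j -> dist g k l -> dist (g ∘ f) m n ->
    exists (u : mor U W) (v : mor W V),
      [/\ dist u v (fmor susp i ∘ l), u ∘ i = m ∘ g, n ∘ u = j,
          v ∘ m = k & l ∘ v = fmor susp f ∘ n] }.

(* A functor F is triangulated when some natural isomorphism F Σ -> Σ F makes it
   preserve distinguished triangles. *)
Definition is_triangulated (C D : triCat) (F : functor C D) : Prop :=
  exists theta : forall X, isom (F (susp C X)) (susp D (F X)),
  (forall X Y (f : mor X Y),
     fmor (susp D) (fmor F f) ∘ theta X = theta Y ∘ fmor F (fmor (susp C) f))
  /\ (forall X Y Z (f : mor X Y) (g : mor Y Z) (h : mor Z (susp C X)),
     dist f g h -> dist (fmor F f) (fmor F g) (theta X ∘ fmor F h)).

Record bifunctor (C D E : addCat) := Bifunctor {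
  bob :> C -> D -> E;
  bmap : forall X X' Y Y', mor X X' -> mor Y Y' -> mor (bob X Y) (bob X' Y');
  bmap1 : forall X Y, bmap (idm X) (idm Y) = idm (bob X Y);
  bmapC : forall X X' X'' Y Y' Y'' (f' : mor X' X'') (f : mor X X')
      (g' : mor Y' Y'') (g : mor Y Y'),
    bmap (f' ∘ f) (g' ∘ g) = bmap f' g' ∘ bmap f g;
  bmapDl : forall X X' Y Y' (f f' : mor X X') (g : mor Y Y'),
    bmap (f + f') g = bmap f g + bmap f' g;
  bmapDr : forall X X' Y Y' (f : mor X X') (g g' : mor Y Y'),
    bmap f (g + g') = bmap f g + bmap f g' }.

Program Definition fixl (C D E : addCat) (B : bifunctor C D E) (X : C) :
    functor D E :=
  @Functor D E (B X) (fun _ _ g => bmap B (idm X) g) _ _ _.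
Next Obligation. by move=> * /=; rewrite bmap1. Qed.
Next Obligation. by move=> * /=; rewrite -bmapC mcomp1m. Qed.
Next Obligation. by move=> * /=; rewrite bmapDr. Qed.

Program Definition fixr (C D E : addCat) (B : bifunctor C D E) (Y : D) :
    functor C E :=
  @Functor C E (fun X => B X Y) (fun _ _ f => bmap B f (idm Y)) _ _ _.
Next Obligation. by move=> * /=; rewrite bmap1. Qed.
Next Obligation. by move=> * /=; rewrite -bmapC mcomp1m. Qed.
Next Obligation. by move=> * /=; rewrite bmapDl. Qed.

Definition bi_triangulated (C D E : triCat) (B : bifunctor C D E) : Prop :=
  (forall X, is_triangulated (C := D) (D := E) (fixl B X)) /\
  (forall Y, is_triangulated (C := C) (D := E) (fixr B Y)).

(* Tensor-triangulated categories; the coherence axioms for the symmetric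
   monoidal structure are Mac Lane's. *)
Record ttCat := TTCat {
  tt_tri :> triCat;
  tens : bifunctor tt_tri tt_tri tt_tri;
  tens_tri : bi_triangulated tens;
  tunit : tt_tri;
  tassoc : forall X Y Z, isom (tens (tens X Y) Z) (tens X (tens Y Z));
  tlunit : forall X, isom (tens tunit X) X;
  trunit : forall X, isom (tens X tunit) X;
  tsym : forall X Y, isom (tens X Y) (tens Y X);
  tassoc_nat : forall X X' Y Y' Z Z'
      (f : mor X X') (g : mor Y Y') (h : mor Z Z'),
    bmap tens f (bmap tens g h) ∘ tassoc X Y Z =
    tassoc X' Y' Z' ∘ bmap tens (bmap tens f g) h;
  tlunit_nat : forall X X' (f : mor X X'),
    f ∘ tlunit X = tlunit X' ∘ bmap tens (idm tunit) f;
  trunit_nat : forall X X' (f : mor X X'),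
    f ∘ trunit X = trunit X' ∘ bmap tens f (idm tunit);
  tsym_nat : forall X X' Y Y' (f : mor X X') (g : mor Y Y'),
    bmap tens g f ∘ tsym X Y = tsym X' Y' ∘ bmap tens f g;
  tpentagon : forall X Y Z W,
    tassoc X Y (tens Z W) ∘ tassoc (tens X Y) Z W =
    bmap tens (idm X) (tassoc Y Z W) ∘ tassoc X (tens Y Z) W
      ∘ bmap tens (tassoc X Y Z) (idm W);
  ttriangle : forall X Y,
    bmap tens (idm X) (tlunit Y) ∘ tassoc X tunit Y =
    bmap tens (trunit X) (idm Y);
  tsymK : forall X Y, tsym Y X ∘ tsym X Y = idm (tens X Y);
  tsym_unit : forall X, tlunit X ∘ tsym X tunit = trunit X;
  thexagon : forall X Y Z,
    tassoc Y Z X ∘ tsym X (tens Y Z) ∘ tassoc X Y Z =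
    bmap tens (idm Y) (tsym X Z) ∘ tassoc Y X Z
      ∘ bmap tens (tsym X Y) (idm Z) }.

(* Actions, with the usual coherence conditions of a module category over a
   monoidal category. *)
Record ttAction (T : ttCat) (K : triCat) := TTAction {
  ttact :> bifunctor T K K;
  ttact_tri : bi_triangulated (C := T) (D := K) (E := K) ttact;
  aassoc : forall (X Y : T) (A : K), isom (ttact (tens T X Y) A) (ttact X (ttact Y A));
  aunit : forall A : K, isom (ttact (tunit T) A) A;
  aassoc_nat : forall (X X' Y Y' : T) (A A' : K)
      (f : mor X X') (g : mor Y Y') (h : mor A A'),
    bmap ttact f (bmap ttact g h) ∘ aassoc X Y A =
    aassoc X' Y' A' ∘ bmap ttact (bmap (tens T) f g) h;
  aunit_nat : forall (A A' : K) (f : mor A A'),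
    f ∘ aunit A = aunit A' ∘ bmap ttact (idm (tunit T)) f;
  apentagon : forall (X Y Z : T) (A : K),
    aassoc X Y (ttact Z A) ∘ aassoc (tens T X Y) Z A =
    bmap ttact (idm X) (aassoc Y Z A) ∘ aassoc X (tens T Y Z) A
      ∘ bmap ttact (tassoc X Y Z) (idm A);
  atriangle : forall (X : T) (A : K),
    bmap ttact (idm X) (aunit A) ∘ aassoc X (tunit T) A =
    bmap ttact (trunit X) (idm A) }.

Lemma mcomp0m (C : addCat) (X Y Z : C) (f : mor X Y) : (0 : mor Y Z) ∘ f = 0.
Proof. by apply: (addrI (0 ∘ f)); rewrite -mcompDl !addr0. Qed.

Lemma mcompm0 (C : addCat) (X Y Z : C) (g : mor Y Z) : g ∘ (0 : mor X Y) = 0.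
Proof. by apply: (addrI (g ∘ 0)); rewrite -mcompDr !addr0. Qed.

Lemma mcompNm (C : addCat) (X Y Z : C) (g : mor Y Z) (f : mor X Y) :
  (- g) ∘ f = - (g ∘ f).
Proof. by apply: (addrI (g ∘ f)); rewrite -mcompDl !subrr mcomp0m. Qed.

Lemma mcompmN (C : addCat) (X Y Z : C) (g : mor Y Z) (f : mor X Y) :
  g ∘ (- f) = - (g ∘ f).
Proof. by apply: (addrI (g ∘ f)); rewrite -mcompDr !subrr mcompm0. Qed.

Lemma mcompBl (C : addCat) (X Y Z : C) (g g' : mor Y Z) (f : mor X Y) :
  (g - g') ∘ f = g ∘ f - g' ∘ f.
Proof. by rewrite mcompDl mcompNm. Qed.

Lemma pr1in1K (C : addCat) (W X Y : C) (h : mor W X) :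
  pr1 (Y := Y) ∘ (in1 ∘ h) = h.
Proof. by rewrite mcompA pr1in1 mcomp1m. Qed.

Lemma pr2in2K (C : addCat) (W X Y : C) (h : mor W Y) :
  pr2 (X := X) ∘ (in2 ∘ h) = h.
Proof. by rewrite mcompA pr2in2 mcomp1m. Qed.

Lemma pr1in2K (C : addCat) (W X Y : C) (h : mor W Y) :
  pr1 (X := X) ∘ (in2 ∘ h) = 0.
Proof. by rewrite mcompA pr1in2 mcomp0m. Qed.

Lemma pr2in1K (C : addCat) (W X Y : C) (h : mor W X) :
  pr2 (Y := Y) ∘ (in1 ∘ h) = 0.
Proof. by rewrite mcompA pr2in1 mcomp0m. Qed.

Definition bipE := (pr1in1, pr2in2, pr1in2, pr2in1,
  pr1in1K, pr2in2K, pr1in2K, pr2in1K, mcomp0m, mcompm0, mcomp1m, mcompm1,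
  addr0, add0r).

Lemma bip_ext (C : addCat) (X Y Z : C) (f g : mor (X ⊕ Y) Z) :
  f ∘ in1 = g ∘ in1 -> f ∘ in2 = g ∘ in2 -> f = g.
Proof.
move=> e1 e2; rewrite -(mcompm1 f) -(mcompm1 g) -bip_id !mcompDr !mcompA.
by rewrite e1 e2.
Qed.

Lemma bipm_in1 (C : addCat) (X X' Y Y' : C) (f : mor X X') (g : mor Y Y') :
  bipm f g ∘ in1 = in1 ∘ f.
Proof. by rewrite /bipm mcompDl -!mcompA !bipE. Qed.

Lemma bipm_in2 (C : addCat) (X X' Y Y' : C) (f : mor X X') (g : mor Y Y') :
  bipm f g ∘ in2 = in2 ∘ g.
Proof. by rewrite /bipm mcompDl -!mcompA !bipE. Qed.

Lemma pr1_bipm (C : addCat) (X X' Y Y' : C) (f : mor X X') (g : mor Y Y') :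
  pr1 ∘ bipm f g = f ∘ pr1.
Proof. by rewrite /bipm mcompDr -!mcompA !bipE. Qed.

Lemma pr2_bipm (C : addCat) (X X' Y Y' : C) (f : mor X X') (g : mor Y Y') :
  pr2 ∘ bipm f g = g ∘ pr2.
Proof. by rewrite /bipm mcompDr -!mcompA !bipE. Qed.

Lemma bipm1 (C : addCat) (X Y : C) : bipm (idm X) (idm Y) = idm (X ⊕ Y).
Proof. by rewrite /bipm !mcompm1 bip_id. Qed.

Lemma bipmC (C : addCat) (X X' X'' Y Y' Y'' : C)
    (f' : mor X' X'') (f : mor X X') (g' : mor Y' Y'') (g : mor Y Y') :
  bipm (f' ∘ f) (g' ∘ g) = bipm f' g' ∘ bipm f g.
Proof. by rewrite /bipm !mcompDl !mcompDr -!mcompA !bipE. Qed.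

Lemma bipmD (C : addCat) (X X' Y Y' : C) (f f' : mor X X') (g g' : mor Y Y') :
  bipm (f + f') (g + g') = bipm f g + bipm f' g'.
Proof. by rewrite /bipm !mcompDr !mcompDl addrACA. Qed.

Definition isom_id (C : addCat) (X : C) : isom X X :=
  Isom (mcomp1m (idm X)) (mcomp1m (idm X)).

Definition isom_inv (C : addCat) (X Y : C) (i : isom X Y) : isom Y X :=
  Isom (fwdK i) (bwdK i).

Lemma isom_comp_subproof (C : addCat) (X Y Z : C) (j : isom Y Z) (i : isom X Y) :
  bwd i ∘ bwd j ∘ (j ∘ i) = idm X.
Proof. by rewrite mcompA -(mcompA (bwd i)) bwdK mcompm1 bwdK. Qed.

Definition isom_comp (C : addCat) (X Y Z : C) (j : isom Y Z) (i : isom X Y) :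
    isom X Z :=
  @Isom C X Z (j ∘ i) (bwd i ∘ bwd j) (isom_comp_subproof j i)
    (isom_comp_subproof (isom_inv i) (isom_inv j)).

Lemma bip_isom_subproof (C : addCat) (X X' Y Y' : C)
    (i : isom X X') (j : isom Y Y') :
  bipm (bwd i) (bwd j) ∘ bipm i j = idm (X ⊕ Y).
Proof. by rewrite -bipmC !bwdK bipm1. Qed.

Definition bip_isom (C : addCat) (X X' Y Y' : C)
    (i : isom X X') (j : isom Y Y') : isom (X ⊕ Y) (X' ⊕ Y') :=
  @Isom C _ _ (bipm i j) (bipm (bwd i) (bwd j)) (bip_isom_subproof i j)
    (bip_isom_subproof (isom_inv i) (isom_inv j)).

Lemma fmor_isom_subproof (C D : addCat) (F : functor C D) (X Y : C)
    (i : isom X Y) : fmor F (bwd i) ∘ fmor F i = idm (F X).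
Proof. by rewrite -fmorC bwdK fmor1. Qed.

Definition fmor_isom (C D : addCat) (F : functor C D) (X Y : C)
    (i : isom X Y) : isom (F X) (F Y) :=
  @Isom D _ _ (fmor F i) (fmor F (bwd i)) (fmor_isom_subproof F i)
    (fmor_isom_subproof F (isom_inv i)).

Lemma fmor0 (C D : addCat) (F : functor C D) (X Y : C) :
  fmor F (0 : mor X Y) = 0.
Proof. by apply: (addrI (fmor F 0)); rewrite -fmorD !addr0. Qed.

Lemma isom_monoR (C : addCat) (X Y Z : C) (i : isom X Y) (f g : mor Y Z) :
  f ∘ i = g ∘ i -> f = g.
Proof.
by move=> e; rewrite -(mcompm1 f) -(mcompm1 g) -(fwdK i) !mcompA e.
Qed.

Lemma isom_monoL (C : addCat) (X Y Z : C) (i : isom Y Z) (f g : mor X Y) :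
  i ∘ f = i ∘ g -> f = g.
Proof.
by move=> e; rewrite -(mcomp1m f) -(mcomp1m g) -(bwdK i) -!mcompA e.
Qed.

Lemma zero_in (C : addCat) (X : C) (f : mor X (zob C)) : f = 0.
Proof. by rewrite -(mcomp1m f) zobP mcomp0m. Qed.

(* The canonical isomorphism F X ⊕ F Y -> F (X ⊕ Y). *)
Definition addF_fwd (C D : addCat) (F : functor C D) (X Y : C) :
    mor (F X ⊕ F Y) (F (X ⊕ Y)) :=
  fmor F in1 ∘ pr1 + fmor F in2 ∘ pr2.

Definition addF_bwd (C D : addCat) (F : functor C D) (X Y : C) :
    mor (F (X ⊕ Y)) (F X ⊕ F Y) :=
  in1 ∘ fmor F pr1 + in2 ∘ fmor F pr2.

Lemma addF_bwdK (C D : addCat) (F : functor C D) (X Y : C) :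
  addF_bwd F X Y ∘ addF_fwd F X Y = idm _.
Proof.
rewrite /addF_bwd /addF_fwd !mcompDl !mcompDr -!mcompA.
rewrite !(mcompA (fmor F _) (fmor F _)) -!fmorC !bipE !fmor1 !fmor0.
by rewrite !bipE bip_id.
Qed.

Lemma addF_fwdK (C D : addCat) (F : functor C D) (X Y : C) :
  addF_fwd F X Y ∘ addF_bwd F X Y = idm _.
Proof.
rewrite /addF_bwd /addF_fwd !mcompDl !mcompDr -!mcompA !bipE.
by rewrite -!fmorC -fmorD bip_id fmor1.
Qed.

Definition addF (C D : addCat) (F : functor C D) (X Y : C) :
    isom (F X ⊕ F Y) (F (X ⊕ Y)) :=
  Isom (addF_bwdK F X Y) (addF_fwdK F X Y).

Lemma addF_in1 (C D : addCat) (F : functor C D) (X Y : C) :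
  addF_fwd F X Y ∘ in1 = fmor F in1.
Proof. by rewrite /addF_fwd mcompDl -!mcompA !bipE. Qed.

Lemma addF_in2 (C D : addCat) (F : functor C D) (X Y : C) :
  addF_fwd F X Y ∘ in2 = fmor F in2.
Proof. by rewrite /addF_fwd mcompDl -!mcompA !bipE. Qed.

Lemma addF_nat (C D : addCat) (F : functor C D) (X X' Y Y' : C)
    (f : mor X X') (g : mor Y Y') :
  fmor F (bipm f g) ∘ addF_fwd F X Y = addF_fwd F X' Y' ∘ bipm (fmor F f) (fmor F g).
Proof.
apply: bip_ext; rewrite -!mcompA.
  by rewrite addF_in1 bipm_in1 mcompA addF_in1 -!fmorC bipm_in1.
by rewrite addF_in2 bipm_in2 mcompA addF_in2 -!fmorC bipm_in2.
Qed.

Lemma dist_comp0 (T : triCat) (X Y Z : T) (f : mor X Y) (g : mor Y Z)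
    (h : mor Z (susp T X)) : dist f g h -> g ∘ f = 0.
Proof.
move=> d; have [|c [e _]] := @TR3 T _ _ _ _ _ _ _ _ _ _ _ _ (idm X) f (TR1_id X) d.
  by [].
by rewrite -e mcompm0.
Qed.

Lemma shift_zob (T : triCat) : idm (susp T (zob T)) = 0.
Proof. by rewrite -fmor1 zobP fmor0. Qed.

Definition zob_shift (T : triCat) : isom (zob T) (susp T (zob T)).
Proof.
exists 0 0; first by rewrite mcomp0m zobP.
by rewrite mcomp0m shift_zob.
Defined.

Lemma dist_zob (T : triCat) (W : T) :
  dist (0 : mor (zob T) W) (idm W) (0 : mor W (susp T (zob T))).
Proof.
apply/TR2; apply: (@TR0 T _ _ _ _ _ _ _ _ _ _ _ _ (isom_id W) (isom_id W) (zob_shift T) _ _ _ (TR1_id W)) => //=.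
- by rewrite mcomp0m mcompm1.
- by rewrite fmor1 fmor0 oppr0 mcompm0 mcomp0m.
Qed.

Lemma dist_ext (T : triCat) (X Y Z W : T) (f : mor X Y) (g : mor Y Z)
    (h : mor Z (susp T X)) (u : mor Y W) :
  dist f g h -> u ∘ f = 0 -> exists w, w ∘ g = u.
Proof.
move=> d e; have [|c [e' _]] := @TR3 T _ _ _ _ _ _ _ _ _ _ _ _ 0 u d (dist_zob W).
  by rewrite e mcomp0m.
by exists c; rewrite e' mcomp1m.
Qed.

Lemma dist_bipm (T : triCat) (X Y Z X' Y' Z' : T)
    (f : mor X Y) (g : mor Y Z) (h : mor Z (susp T X))
    (f' : mor X' Y') (g' : mor Y' Z') (h' : mor Z' (susp T X')) :
  dist f g h -> dist f' g' h' ->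
  dist (bipm f f') (bipm g g') (addF_fwd (susp T) X X' ∘ bipm h h').
Proof.
move=> d d'; have [Z'' [k [l d'']]] := TR1_cone (bipm f f').
have [|c1 [kc1 lc1]] := TR3 (a := in1) (b := in1) d d''.
  by rewrite bipm_in1.
have [|c2 [kc2 lc2]] := TR3 (a := in2) (b := in2) d' d''.
  by rewrite bipm_in2.
have dr : dist g h (- fmor (susp T) f) by exact: (proj1 (TR2 _ _ _) d).
have dr' : dist g' h' (- fmor (susp T) f') by exact: (proj1 (TR2 _ _ _) d').
have dr'' : dist k l (- fmor (susp T) (bipm f f')) by exact: (proj1 (TR2 _ _ _) d'').
have drr : dist h (- fmor (susp T) f) (- fmor (susp T) g) by exact: (proj1 (TR2 _ _ _) dr).
have drr' : dist h' (- fmor (susp T) f') (- fmor (susp T) g') by exact: (proj1 (TR2 _ _ _) dr').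
have drr'' := proj1 (TR2 _ _ _) dr''.
pose phi : mor (Z ⊕ Z') Z'' := c1 ∘ pr1 + c2 ∘ pr2.
have phi1 : phi ∘ in1 = c1 by rewrite /phi mcompDl -!mcompA !bipE.
have phi2 : phi ∘ in2 = c2 by rewrite /phi mcompDl -!mcompA !bipE.
have inj W (u : mor Z'' W) : u ∘ phi = 0 -> u = 0.
  move=> u0.
  have u1 : u ∘ c1 = 0 by rewrite -phi1 mcompA u0 mcomp0m.
  have u2 : u ∘ c2 = 0 by rewrite -phi2 mcompA u0 mcomp0m.
  have uk : u ∘ k = 0.
    apply: bip_ext; rewrite mcomp0m -mcompA.
      by rewrite -kc1 mcompA u1 mcomp0m.
    by rewrite -kc2 mcompA u2 mcomp0m.
  have [w wl] := dist_ext dr'' uk.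
  have [|w1 ew1] := @dist_ext T _ _ _ _ _ _ _ (w ∘ fmor (susp T) in1) drr.
    by rewrite -mcompA lc1 mcompA wl.
  have [|w2 ew2] := @dist_ext T _ _ _ _ _ _ _ (w ∘ fmor (susp T) in2) drr'.
    by rewrite -mcompA lc2 mcompA wl.
  have wE : w = - (w1 ∘ fmor (susp T) pr1 + w2 ∘ fmor (susp T) pr2)
               ∘ fmor (susp T) (bipm f f').
    apply: (isom_monoR (i := addF (susp T) X X')); apply: bip_ext; rewrite /= -!mcompA.
      rewrite addF_in1 -ew1 -fmorC bipm_in1 mcompNm mcompDl mcompmN -!mcompA.
      by rewrite -!fmorC !bipE fmor0 !bipE.
    rewrite addF_in2 -ew2 -fmorC bipm_in2 mcompNm mcompDl mcompmN -!mcompA.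
    by rewrite -!fmorC !bipE fmor0 !bipE.
  rewrite -wl wE -mcompA.
  have := dist_comp0 drr''; rewrite mcompNm => /eqP; rewrite oppr_eq0 => /eqP ->.
  by rewrite mcompm0.
have surj W (v : mor (Z ⊕ Z') W) : exists u, u ∘ phi = v.
  have [|u uk] := @dist_ext T _ _ _ W _ _ _ (v ∘ bipm g g') d''.
    by rewrite -mcompA -bipmC !(dist_comp0 d, dist_comp0 d') /bipm !bipE.
  have [|w1 ew1] := @dist_ext T _ _ _ W _ _ _ (v ∘ in1 - u ∘ c1) dr.
    by rewrite mcompBl -!mcompA kc1 -(bipm_in1 g g') !mcompA -uk -!mcompA subrr.
  have [|w2 ew2] := @dist_ext T _ _ _ W _ _ _ (v ∘ in2 - u ∘ c2) dr'.
    by rewrite mcompBl -!mcompA kc2 -(bipm_in2 g g') !mcompA -uk -!mcompA subrr.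
  exists (u + (w1 ∘ fmor (susp T) pr1 + w2 ∘ fmor (susp T) pr2) ∘ l).
  apply: bip_ext; rewrite -mcompA.
    rewrite phi1 mcompDl -!mcompA -lc1 mcompDl -!mcompA !(mcompA (fmor _ _) (fmor _ _)).
    by rewrite -!fmorC !bipE fmor0 fmor1 !bipE ew1 addrC subrK.
  rewrite phi2 mcompDl -!mcompA -lc2 mcompDl -!mcompA !(mcompA (fmor _ _) (fmor _ _)).
  by rewrite -!fmorC !bipE fmor0 fmor1 !bipE ew2 addrC subrK.
have [psi psiK] := surj _ (idm _).
have phiK : phi ∘ psi = idm _.
  apply/eqP; rewrite -subr_eq0; apply/eqP/inj.
  by rewrite mcompBl -mcompA psiK mcompm1 mcomp1m subrr.
apply: (@TR0 T _ _ _ _ _ _ _ _ _ _ _ _ (isom_id _) (isom_id _) (Isom phiK psiK) _ _ _ d'') => /=.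
- by rewrite mcomp1m mcompm1.
- rewrite mcompm1 -(mcomp1m (bipm g g')) -psiK -mcompA; congr (_ ∘ _).
  apply: bip_ext; rewrite -!mcompA.
    by rewrite bipm_in1 mcompA phi1 kc1.
  by rewrite bipm_in2 mcompA phi2 kc2.
- rewrite fmor1 mcomp1m -(mcompm1 l) -phiK mcompA; congr (_ ∘ _).
  apply: bip_ext; rewrite -!mcompA.
    by rewrite phi1 bipm_in1 mcompA addF_in1 lc1.
  by rewrite phi2 bipm_in2 mcompA addF_in2 lc2.
Qed.

Program Definition prodC (C D : addCat) : addCat := @AddCat (C * D)%type
  (fun P Q => prodAb (mor P.1 Q.1) (mor P.2 Q.2))
  (fun P => (idm P.1, idm P.2))
  (fun _ _ _ g f => (g.1 ∘ f.1, g.2 ∘ f.2)) _ _ _ _ _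
  (zob C, zob D) _
  (fun P Q => (P.1 ⊕ Q.1, P.2 ⊕ Q.2))
  (fun _ _ => (in1, in1)) (fun _ _ => (in2, in2))
  (fun _ _ => (pr1, pr1)) (fun _ _ => (pr2, pr2)) _ _ _ _ _.
Next Obligation. by move=> C D P Q [f g] /=; rewrite !mcomp1m. Qed.
Next Obligation. by move=> C D P Q [f g] /=; rewrite !mcompm1. Qed.
Next Obligation. by move=> * /=; rewrite !mcompA. Qed.
Next Obligation. by move=> * /=; rewrite !mcompDl. Qed.
Next Obligation. by move=> * /=; rewrite !mcompDr. Qed.
Next Obligation. by move=> * /=; rewrite !zobP. Qed.
Next Obligation. by move=> * /=; rewrite !pr1in1. Qed.
Next Obligation. by move=> * /=; rewrite !pr2in2. Qed.
Next Obligation. by move=> * /=; rewrite !pr1in2. Qed.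
Next Obligation. by move=> * /=; rewrite !pr2in1. Qed.
Next Obligation. by move=> C D P Q /=; congr (_, _); exact: bip_id. Qed.

Definition pair_isom (C D : addCat) (P Q : prodC C D)
    (i : isom P.1 Q.1) (j : isom P.2 Q.2) : isom P Q.
Proof.
exists (i : mor _ _, j : mor _ _) (bwd i, bwd j) => /=.
  by rewrite !bwdK.
by rewrite !fwdK.
Defined.

Definition isom_fst (C D : addCat) (P Q : prodC C D) (i : isom P Q) :
    isom P.1 Q.1.
Proof.
exists (fwd i).1 (bwd i).1; first exact: (congr1 fst (bwdK i)).
exact: (congr1 fst (fwdK i)).
Defined.

Definition isom_snd (C D : addCat) (P Q : prodC C D) (i : isom P Q) :
    isom P.2 Q.2.
Proof.
exists (fwd i).2 (bwd i).2; first exact: (congr1 snd (bwdK i)).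
exact: (congr1 snd (fwdK i)).
Defined.

Program Definition prodF (C C' D D' : addCat) (F : functor C C')
    (G : functor D D') : functor (prodC C D) (prodC C' D') :=
  @Functor (prodC C D) (prodC C' D') (fun P => (F P.1, G P.2))
    (fun _ _ f => (fmor F f.1, fmor G f.2)) _ _ _.
Next Obligation. by move=> * /=; rewrite !fmor1. Qed.
Next Obligation. by move=> * /=; rewrite !fmorC. Qed.
Next Obligation. by move=> * /=; rewrite !fmorD. Qed.

Lemma prodF_equiv (C C' D D' : addCat) (F : functor C C') (G : functor D D') :
  is_equivalence F -> is_equivalence G -> is_equivalence (prodF F G).
Proof.
move=> [F' [[a aN] [b bN]]] [G' [[c cN] [d dN]]]; exists (prodF F' G'); split.
  exists (fun P : prodC C D => @pair_isom C D (compF (prodF F' G') (prodF F G) P) P (a P.1) (c P.2)).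
  by move=> P Q [f g] /=; congr (_, _); [exact: aN | exact: cN].
exists (fun P : prodC C' D' => @pair_isom C' D' (compF (prodF F G) (prodF F' G') P) P (b P.1) (d P.2)).
by move=> P Q [f g] /=; congr (_, _); [exact: bN | exact: dN].
Qed.

Lemma pair_eq (A B : Type) (p q : A * B) : p.1 = q.1 -> p.2 = q.2 -> p = q.
Proof. by case: p q => [a b] [c d] /= -> ->. Qed.

Program Definition prodT (C D : triCat) : triCat := @TriCat (prodC C D)
  (prodF (susp C) (susp D)) (prodF_equiv (susp_equiv C) (susp_equiv D))
  (fun _ _ _ f g h => dist f.1 g.1 h.1 /\ dist f.2 g.2 h.2) _ _ _ _ _ _.
Next Obligation.
move=> C D X Y Z X' Y' Z' f g h f' g' h' a b c e1 e2 e3 [d1 d2]; split.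
  exact: (TR0 (a := isom_fst a) (b := isom_fst b) (c := isom_fst c)
    (congr1 fst e1) (congr1 fst e2) (congr1 fst e3) d1).
exact: (TR0 (a := isom_snd a) (b := isom_snd b) (c := isom_snd c)
  (congr1 snd e1) (congr1 snd e2) (congr1 snd e3) d2).
Qed.
Next Obligation. by move=> C D X; split; exact: TR1_id. Qed.
Next Obligation.
move=> C D X Y f; have [Z1 [g1 [h1 d1]]] := TR1_cone f.1.
have [Z2 [g2 [h2 d2]]] := TR1_cone f.2.
by exists (Z1, Z2), (g1, g2), (h1, h2).
Qed.
Next Obligation.
move=> C D X Y Z f g h; split=> -[d1 d2].
  by split; [exact: (proj1 (TR2 _ _ _) d1) | exact: (proj1 (TR2 _ _ _) d2)].
by split; [exact: (proj2 (TR2 _ _ _) d1) | exact: (proj2 (TR2 _ _ _) d2)].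
Qed.
Next Obligation.
move=> C D X Y Z X' Y' Z' f g h f' g' h' a b [d1 d2] [d1' d2'] e.
have [c1 [e1 e1']] := TR3 d1 d1' (congr1 fst e).
have [c2 [e2 e2']] := TR3 d2 d2' (congr1 snd e).
by exists (c1, c2); split; apply: pair_eq.
Qed.
Next Obligation.
move=> C D X Y Z U V W f g i j k l m n [d1 d1'] [d2 d2'] [d3 d3'].
have [u [v [e1 e2 e3 e4 e5]]] := TR4 d1 d2 d3.
have [u' [v' [e1' e2' e3' e4' e5']]] := TR4 d1' d2' d3'.
by exists (u, u'), (v, v'); split; do ?apply: pair_eq.
Qed.

Program Definition fstF (C D : addCat) : functor (prodC C D) C :=
  @Functor (prodC C D) C fst (fun _ _ f => f.1) _ _ _.
Next Obligation. by []. Qed.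
Next Obligation. by []. Qed.
Next Obligation. by []. Qed.

Program Definition sndF (C D : addCat) : functor (prodC C D) D :=
  @Functor (prodC C D) D snd (fun _ _ f => f.2) _ _ _.
Next Obligation. by []. Qed.
Next Obligation. by []. Qed.
Next Obligation. by []. Qed.

Program Definition pairF (C D E : addCat) (F : functor C D) (G : functor C E) :
    functor C (prodC D E) :=
  @Functor C (prodC D E) (fun X => (F X, G X)) (fun _ _ f => (fmor F f, fmor G f))
    _ _ _.
Next Obligation. by move=> * /=; rewrite !fmor1. Qed.
Next Obligation. by move=> * /=; rewrite !fmorC. Qed.
Next Obligation. by move=> * /=; rewrite !fmorD. Qed.

Program Definition sumF (C D : addCat) (F G : functor C D) : functor C D :=
  @Functor C D (fun X => F X ⊕ G X) (fun _ _ f => bipm (fmor F f) (fmor G f))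
    _ _ _.
Next Obligation. by move=> * /=; rewrite !fmor1 bipm1. Qed.
Next Obligation. by move=> * /=; rewrite !fmorC bipmC. Qed.
Next Obligation. by move=> * /=; rewrite !fmorD bipmD. Qed.

Lemma fstF_tri (C D : triCat) :
  is_triangulated (C := prodT C D) (D := C) (fstF C D).
Proof.
exists (fun X : prodT C D => isom_id (susp C X.1)); split=> [X Y f|X Y Z f g h [d _]] /=.
  by rewrite mcomp1m mcompm1.
by rewrite mcomp1m.
Qed.

Lemma sndF_tri (C D : triCat) :
  is_triangulated (C := prodT C D) (D := D) (sndF C D).
Proof.
exists (fun X : prodT C D => isom_id (susp D X.2)); split=> [X Y f|X Y Z f g h [_ d]] /=.
  by rewrite mcomp1m mcompm1.
by rewrite mcomp1m.
Qed.

Lemma compF_tri (C D E : triCat) (G : functor D E) (F : functor C D) :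
  is_triangulated G -> is_triangulated F ->
  is_triangulated (C := C) (D := E) (compF G F).
Proof.
move=> [s [sN sD]] [t [tN tD]].
exists (fun X => isom_comp (s (F X)) (fmor_isom G (t X))); split=> /=.
  by move=> X Y f; rewrite mcompA sN -!mcompA -!fmorC tN.
move=> X Y Z f g h d; rewrite -mcompA -fmorC.
by apply: sD; apply: tD.
Qed.

Lemma pairF_tri (C D E : triCat) (F : functor C D) (G : functor C E) :
  is_triangulated F -> is_triangulated G ->
  is_triangulated (C := C) (D := prodT D E) (pairF F G).
Proof.
move=> [s [sN sD]] [t [tN tD]].
exists (fun X => @pair_isom D E (pairF F G (susp C X)) (susp (prodT D E) (pairF F G X)) (s X) (t X)).
split=> /=; first by move=> X Y f; rewrite sN tN.
by move=> X Y Z f g h d; split; [exact: sD|exact: tD].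
Qed.

Lemma sumF_tri (C D : triCat) (F G : functor C D) :
  is_triangulated F -> is_triangulated G ->
  is_triangulated (C := C) (D := D) (sumF F G).
Proof.
move=> [s [sN sD]] [t [tN tD]].
exists (fun X => isom_comp (addF (susp D) (F X) (G X)) (bip_isom (s X) (t X))).
split=> /=.
  move=> X Y f; rewrite mcompA addF_nat -!mcompA; congr (_ ∘ _).
  by rewrite -!bipmC sN tN.
move=> X Y Z f g h d; rewrite -mcompA -bipmC.
by apply: dist_bipm; [exact: sD|exact: tD].
Qed.

Lemma tl (C : addCat) (X Y Z V : C) (g : mor Y Z) (f : mor X Y) (k : mor X Z) :
  g ∘ f = k -> forall h : mor V X, g ∘ (f ∘ h) = k ∘ h.
Proof. by move=> e h; rewrite mcompA e. Qed.

Lemma bmapr (C D E : addCat) (B : bifunctor C D E) (X : C) (Y Y' Y'' : D)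
    (g' : mor Y' Y'') (g : mor Y Y') :
  bmap B (idm X) g' ∘ bmap B (idm X) g = bmap B (idm X) (g' ∘ g).
Proof. by rewrite -bmapC mcomp1m. Qed.

Lemma bmapl (C D E : addCat) (B : bifunctor C D E) (X X' X'' : C) (Y : D)
    (f' : mor X' X'') (f : mor X X') :
  bmap B f' (idm Y) ∘ bmap B f (idm Y) = bmap B (f' ∘ f) (idm Y).
Proof. by rewrite -bmapC mcomp1m. Qed.

Lemma bmap0r (C D E : addCat) (B : bifunctor C D E) (X X' : C) (Y Y' : D)
    (f : mor X X') : bmap B f (0 : mor Y Y') = 0.
Proof. by apply: (addrI (bmap B f 0)); rewrite -bmapDr !addr0. Qed.

Lemma bmap0l (C D E : addCat) (B : bifunctor C D E) (X X' : C) (Y Y' : D)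
    (g : mor Y Y') : bmap B (0 : mor X X') g = 0.
Proof. by apply: (addrI (bmap B 0 g)); rewrite -bmapDl !addr0. Qed.

Lemma bmap_isom_subproof (C D E : addCat) (B : bifunctor C D E) (X X' : C)
    (Y Y' : D) (i : isom X X') (j : isom Y Y') :
  bmap B (bwd i) (bwd j) ∘ bmap B i j = idm (B X Y).
Proof. by rewrite -bmapC !bwdK bmap1. Qed.

Definition bmap_isom (C D E : addCat) (B : bifunctor C D E) (X X' : C)
    (Y Y' : D) (i : isom X X') (j : isom Y Y') : isom (B X Y) (B X' Y') :=
  @Isom E _ _ (bmap B i j) (bmap B (bwd i) (bwd j)) (bmap_isom_subproof B i j)
    (bmap_isom_subproof B (isom_inv i) (isom_inv j)).

Lemma act_ext (C D E : addCat) (B : bifunctor C D E) (X : C) (Y Y' : D) (Z : E)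
    (f g : mor (B X (Y ⊕ Y')) Z) :
  f ∘ bmap B (idm X) in1 = g ∘ bmap B (idm X) in1 ->
  f ∘ bmap B (idm X) in2 = g ∘ bmap B (idm X) in2 -> f = g.
Proof.
move=> e1 e2; rewrite -(mcompm1 f) -(mcompm1 g) -bmap1 -bip_id bmapDr.
by rewrite -!bmapr !mcompDr !mcompA e1 e2.
Qed.

Lemma bwd_nat (C : addCat) (X X' Y Y' : C) (i : isom X Y) (j : isom X' Y')
    (f : mor X X') (g : mor Y Y') : g ∘ i = j ∘ f -> f ∘ bwd i = bwd j ∘ g.
Proof.
move=> e; apply: (isom_monoR (i := i)); apply: (isom_monoL (i := j)).
by rewrite -!mcompA bwdK mcompm1 (tl (fwdK j)) mcomp1m e.
Qed.

Lemma act_ext2 (C : addCat) (E : addCat) (B : bifunctor C E E) (S R : C)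
    (Y Y' Z : E) (f g : mor (B S (B R (Y ⊕ Y'))) Z) :
  f ∘ bmap B (idm S) (bmap B (idm R) in1) =
    g ∘ bmap B (idm S) (bmap B (idm R) in1) ->
  f ∘ bmap B (idm S) (bmap B (idm R) in2) =
    g ∘ bmap B (idm S) (bmap B (idm R) in2) -> f = g.
Proof.
move=> e1 e2; rewrite -(mcompm1 f) -(mcompm1 g) -bmap1 -bmap1 -bip_id.
by rewrite !bmapDr -!bmapr !mcompDr !mcompA e1 e2.
Qed.

Lemma bmap_bipm_in1 (C D E : addCat) (B : bifunctor C D E) (X X' : C)
    (Y Y' Z Z' : D) (f : mor X X') (u : mor Y Y') (v : mor Z Z') :
  bmap B f (bipm u v) ∘ bmap B (idm X) in1 = bmap B (idm X') in1 ∘ bmap B f u.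
Proof. by rewrite -!bmapC mcomp1m mcompm1 bipm_in1. Qed.

Lemma bmap_bipm_in2 (C D E : addCat) (B : bifunctor C D E) (X X' : C)
    (Y Y' Z Z' : D) (f : mor X X') (u : mor Y Y') (v : mor Z Z') :
  bmap B f (bipm u v) ∘ bmap B (idm X) in2 = bmap B (idm X') in2 ∘ bmap B f v.
Proof. by rewrite -!bmapC mcomp1m mcompm1 bipm_in2. Qed.

Definition bipA_fwd (C : addCat) (X Y Z : C) : mor (X ⊕ (Y ⊕ Z)) (X ⊕ Y ⊕ Z) :=
  in1 ∘ in1 ∘ pr1 + (in1 ∘ in2 ∘ pr1 + in2 ∘ pr2) ∘ pr2.

Definition bipA_bwd (C : addCat) (X Y Z : C) : mor (X ⊕ Y ⊕ Z) (X ⊕ (Y ⊕ Z)) :=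
  (in1 ∘ pr1 + in2 ∘ in1 ∘ pr2) ∘ pr1 + in2 ∘ in2 ∘ pr2.

Lemma bipA_bwdK (C : addCat) (X Y Z : C) :
  bipA_bwd X Y Z ∘ bipA_fwd X Y Z = idm _.
Proof.
rewrite /bipA_bwd /bipA_fwd; apply: bip_ext; last apply: bip_ext;
  by rewrite !(mcompDl, mcompDr) -!mcompA !bipE.
Qed.

Lemma bipA_fwdK (C : addCat) (X Y Z : C) :
  bipA_fwd X Y Z ∘ bipA_bwd X Y Z = idm _.
Proof.
rewrite /bipA_bwd /bipA_fwd; apply: bip_ext; first apply: bip_ext;
  by rewrite !(mcompDl, mcompDr) -!mcompA !bipE.
Qed.

Definition bipA (C : addCat) (X Y Z : C) : isom (X ⊕ (Y ⊕ Z)) (X ⊕ Y ⊕ Z) :=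
  Isom (bipA_bwdK X Y Z) (bipA_fwdK X Y Z).

Lemma bipA_in1 (C : addCat) (X Y Z : C) : bipA_fwd X Y Z ∘ in1 = in1 ∘ in1.
Proof. by rewrite /bipA_fwd !mcompDl -!mcompA !bipE. Qed.

Lemma bipA_in21 (C : addCat) (X Y Z : C) :
  bipA_fwd X Y Z ∘ (in2 ∘ in1) = in1 ∘ in2.
Proof. by rewrite /bipA_fwd !mcompDl -!mcompA !bipE. Qed.

Lemma bipA_in22 (C : addCat) (X Y Z : C) : bipA_fwd X Y Z ∘ (in2 ∘ in2) = in2.
Proof. by rewrite /bipA_fwd !mcompDl -!mcompA !bipE. Qed.

Definition bipC_fwd (C : addCat) (X Y : C) : mor (X ⊕ Y) (Y ⊕ X) :=
  in2 ∘ pr1 + in1 ∘ pr2.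

Lemma bipC_K (C : addCat) (X Y : C) : bipC_fwd Y X ∘ bipC_fwd X Y = idm _.
Proof.
by rewrite /bipC_fwd; apply: bip_ext; rewrite !(mcompDl, mcompDr) -!mcompA !bipE.
Qed.

Definition bipC (C : addCat) (X Y : C) : isom (X ⊕ Y) (Y ⊕ X) :=
  Isom (bipC_K X Y) (bipC_K Y X).

Lemma bipC_in1 (C : addCat) (X Y : C) : bipC_fwd X Y ∘ in1 = in2.
Proof. by rewrite /bipC_fwd !mcompDl -!mcompA !bipE. Qed.

Lemma bipC_in2 (C : addCat) (X Y : C) : bipC_fwd X Y ∘ in2 = in1.
Proof. by rewrite /bipC_fwd !mcompDl -!mcompA !bipE. Qed.

(* U ⊕ B Z (W ⊕ W2) -> U ⊕ (B Z W ⊕ B Z W2) -> B X V ⊕ (B X W1 ⊕ U2)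
   -> (B X V ⊕ B X W1) ⊕ U2 -> B X (V ⊕ W1) ⊕ U2 *)
Definition bip_assoc (C E : addCat) (B : bifunctor C E E) (X Z : C)
    (U V W W1 W2 U2 : E) (a : isom U (B X V)) (s : isom (B Z W) (B X W1))
    (t : isom (B Z W2) U2) : isom (U ⊕ B Z (W ⊕ W2)) (B X (V ⊕ W1) ⊕ U2) :=
  isom_comp (bip_isom (addF (fixl B X) V W1) (isom_id U2))
    (isom_comp (bipA _ _ _)
      (isom_comp (bip_isom a (bip_isom s t))
        (bip_isom (isom_id U) (isom_inv (addF (fixl B Z) W W2))))).

Lemma addB_in1 (C D E : addCat) (B : bifunctor C D E) (X : C) (V W : D) :
  @mcomp E (B X V) (B X V ⊕ B X W) (B X (V ⊕ W)) (addF_fwd (fixl B X) V W) in1 =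
  bmap B (idm X) in1.
Proof. exact: (addF_in1 (fixl B X) V W). Qed.

Lemma addB_in2 (C D E : addCat) (B : bifunctor C D E) (X : C) (V W : D) :
  @mcomp E (B X W) (B X V ⊕ B X W) (B X (V ⊕ W)) (addF_fwd (fixl B X) V W) in2 =
  bmap B (idm X) in2.
Proof. exact: (addF_in2 (fixl B X) V W). Qed.

Section BipAssoc.
Context (C E : addCat) (B : bifunctor C E E) (X Z : C).
Context (U V W W1 W2 U2 : E) (a : isom U (B X V)) (s : isom (B Z W) (B X W1)).
Context (t : isom (B Z W2) U2).

Lemma bip_assoc_in1 : bip_assoc a s t ∘ in1 = in1 ∘ bmap B (idm X) in1 ∘ a.
Proof.
rewrite /= -!mcompA bipm_in1 mcompm1 bipm_in1 (tl (bipA_in1 _ _ _)) -!mcompA.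
by rewrite (tl (bipm_in1 _ _)) -!mcompA (tl (addB_in1 _ _ _ _)).
Qed.

Lemma bip_assoc_in21 :
  bip_assoc a s t ∘ in2 ∘ bmap B (idm Z) in1 = in1 ∘ bmap B (idm X) in2 ∘ s.
Proof.
rewrite /= -!mcompA (tl (bipm_in2 _ _)) -!mcompA.
have -> : addF_bwd (fixl B Z) W W2 ∘ bmap B (idm Z) in1 = in1.
  rewrite -[bmap B _ in1]/(fmor (fixl B Z) in1) -addF_in1 mcompA addF_bwdK.
  by rewrite mcomp1m.
rewrite (tl (bipm_in2 _ _)) -!mcompA bipm_in1.
rewrite (mcompA in2) (tl (bipA_in21 _ _ _)) -!mcompA.
by rewrite (tl (bipm_in1 _ _)) -!mcompA (tl (addB_in2 _ _ _ _)).
Qed.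

Lemma bip_assoc_in22 :
  bip_assoc a s t ∘ in2 ∘ bmap B (idm Z) in2 = in2 ∘ t.
Proof.
rewrite /= -!mcompA (tl (bipm_in2 _ _)) -!mcompA.
have -> : addF_bwd (fixl B Z) W W2 ∘ bmap B (idm Z) in2 = in2.
  rewrite -[bmap B _ in2]/(fmor (fixl B Z) in2) -addF_in2 mcompA addF_bwdK.
  by rewrite mcomp1m.
rewrite (tl (bipm_in2 _ _)) -!mcompA bipm_in2.
rewrite (mcompA in2) (tl (bipA_in22 _ _ _)).
by rewrite (tl (bipm_in2 _ _)) mcompm1.
Qed.

End BipAssoc.

Section TrivialExtension.
Context {T : ttCat} {K : triCat} (A : ttAction T K).

Local Notation "X ⊗ Y" := (tens T X Y) (at level 40, left associativity).
Local Notation "X ◁ f" := (bmap (ttact A) (idm X) f) (at level 38, right associativity).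
Local Notation "f ▷ B" := (bmap (ttact A) f (idm B)) (at level 38).

Lemma aassoc_bwd_nat (X X' Y Y' : T) (B B' : K)
    (f : mor X X') (g : mor Y Y') (h : mor B B') :
  bmap A (bmap (tens T) f g) h ∘ bwd (aassoc A X Y B) =
  bwd (aassoc A X' Y' B') ∘ bmap A f (bmap A g h).
Proof. exact: bwd_nat (aassoc_nat A f g h). Qed.

Lemma aassoc_natl (X X' Y : T) (B : K) (f : mor X X') :
  f ▷ A Y B ∘ aassoc A X Y B = aassoc A X' Y B ∘ bmap (tens T) f (idm Y) ▷ B.
Proof. by rewrite -aassoc_nat bmap1. Qed.

Lemma aassoc_natm (X Y Y' : T) (B : K) (f : mor Y Y') :
  X ◁ (f ▷ B) ∘ aassoc A X Y B = aassoc A X Y' B ∘ bmap (tens T) (idm X) f ▷ B.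
Proof. by rewrite -aassoc_nat. Qed.

(* The coherence identities are proved for arbitrary isomorphisms satisfying
   the equations below, so that rewriting does not unfold their definitions. *)
Section Coherence.
Context (tw : forall (Z Y : T) (B : K), isom (A Z (A Y B)) (A (Y ⊗ Z) B)).
Context (sw : forall (Z Y : T) (B : K), isom (A Z (A Y B)) (A Y (A Z B))).
Context (tw_aassoc : forall (Z Y : T) (B : K),
  tw Z Y B ∘ aassoc A Z Y B = tsym Z Y ▷ B).
Context (sw_aassoc : forall (Z Y : T) (B : K),
  sw Z Y B ∘ aassoc A Z Y B = aassoc A Y Z B ∘ tsym Z Y ▷ B).

Lemma tw_nat (X X' Y Y' : T) (B B' : K)
    (f : mor X X') (g : mor Y Y') (h : mor B B') :
  bmap A (bmap (tens T) g f) h ∘ tw X Y B = tw X' Y' B' ∘ bmap A f (bmap A g h).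
Proof.
apply: (isom_monoR (i := aassoc A X Y B)).
rewrite -!mcompA tw_aassoc aassoc_nat (tl (tw_aassoc _ _ _)).
by rewrite -!bmapC tsym_nat mcomp1m mcompm1.
Qed.

Lemma sw_nat (X X' Y Y' : T) (B B' : K)
    (f : mor X X') (g : mor Y Y') (h : mor B B') :
  bmap A g (bmap A f h) ∘ sw X Y B = sw X' Y' B' ∘ bmap A f (bmap A g h).
Proof.
apply: (isom_monoR (i := aassoc A X Y B)).
rewrite -!mcompA sw_aassoc aassoc_nat (tl (sw_aassoc _ _ _)).
rewrite (tl (aassoc_nat _ _ _ _)) -!mcompA -!bmapC tsym_nat.
by rewrite mcomp1m mcompm1.
Qed.

Lemma swK (X Y : T) (B : K) : sw Y X B ∘ sw X Y B = idm _.
Proof.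
apply: (isom_monoR (i := aassoc A X Y B)).
rewrite -!mcompA sw_aassoc (tl (sw_aassoc _ _ _)) -!mcompA bmapl tsymK bmap1.
by rewrite mcompm1 mcomp1m.
Qed.

Lemma tsym_sw (X Y : T) (B : K) : tsym X Y ▷ B ∘ tw Y X B = bwd (aassoc A Y X B).
Proof.
apply: (isom_monoR (i := aassoc A Y X B)).
by rewrite -mcompA tw_aassoc bmapl tsymK bmap1 bwdK.
Qed.

Lemma aassoc_tw (X Y : T) (B : K) : aassoc A Y X B ∘ tw X Y B = sw X Y B.
Proof.
apply: (isom_monoR (i := aassoc A X Y B)).
by rewrite -mcompA tw_aassoc sw_aassoc.
Qed.

Lemma sw_tens (X Y Z : T) (B : K) :
  aassoc A X Y (A Z B) ∘ sw Z (X ⊗ Y) B =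
  X ◁ sw Z Y B ∘ sw Z X (A Y B) ∘ Z ◁ aassoc A X Y B.
Proof.
apply: (isom_monoR (i := aassoc A Z (X ⊗ Y) B)).
apply: (isom_monoR (i := bmap_isom A (tassoc Z X Y) (isom_id B))).
rewrite -[fwd (bmap_isom _ _ _)]/(tassoc Z X Y ▷ B).
rewrite -!mcompA (mcompA (Z ◁ _)) -apentagon.
rewrite (tl (sw_aassoc _ _ _)) -!mcompA (tl (apentagon _ _ _ _ _)).
rewrite (tl (sw_aassoc _ _ _)) -!mcompA aassoc_natl.
rewrite (tl (apentagon _ _ _ _ _)) -!mcompA !bmapl [tassoc X Y Z ∘ _]mcompA thexagon.
rewrite (tl (bmapr _ _ _ _)) sw_aassoc -(bmapr _ _ (aassoc _ _ _ _)) -!mcompA.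
by rewrite (tl (aassoc_natm _ _ _)) -!mcompA bmapl !mcompA.
Qed.

Lemma sw_tens_inv (X Y Z : T) (B : K) :
  X ◁ aassoc A Z Y B ∘ sw (Z ⊗ Y) X B =
  sw Z X (A Y B) ∘ Z ◁ sw Y X B ∘ aassoc A Z Y (A X B).
Proof.
apply: (isom_monoR (i := sw X (Z ⊗ Y) B)); rewrite -!mcompA swK sw_tens.
rewrite -!mcompA (tl (bmapr _ _ _ _)) swK bmap1 mcomp1m (tl (swK _ _ _)).
by rewrite mcomp1m mcompm1.
Qed.

Lemma sw_tw (X Y Z : T) (B : K) :
  sw (Y ⊗ Z) X B ∘ tw Z Y (A X B) =
  X ◁ tw Z Y B ∘ sw Z X (A Y B) ∘ Z ◁ sw Y X B.
Proof.
apply: (isom_monoR (i := aassoc A Z Y (A X B))).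
rewrite -!mcompA tw_aassoc (mcompA (sw _ _ _) (_ ◁ _)) -sw_tens_inv.
rewrite (tl (bmapr _ _ _ _)) tw_aassoc -(bmap1 A X B).
by rewrite -sw_nat.
Qed.

Lemma hexagon_inv (X Y Z : T) :
  tassoc X Y Z ∘ bmap (tens T) (tsym Y X) (idm Z) ∘ bwd (tassoc Y X Z)
    ∘ bmap (tens T) (idm Y) (tsym Z X) ∘ tassoc Y Z X = tsym (Y ⊗ Z) X.
Proof.
apply: (isom_monoR (i := tsym X (Y ⊗ Z))); rewrite tsymK.
apply: (isom_monoR (i := tassoc X Y Z)); rewrite mcomp1m.
rewrite -!mcompA (mcompA (tassoc Y Z X)) thexagon -!mcompA.
rewrite (tl (bmapr _ _ _ _)) tsymK bmap1 mcomp1m (tl (bwdK _)) mcomp1m.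
by rewrite bmapl tsymK bmap1 mcompm1.
Qed.

Lemma tsym_tsym (X Y Z : T) :
  tassoc X Y Z ∘ tsym Z (X ⊗ Y) ∘ bmap (tens T) (idm Z) (tsym Y X)
    ∘ tassoc Z Y X = tsym (Y ⊗ Z) X ∘ bmap (tens T) (tsym Z Y) (idm X).
Proof.
rewrite -hexagon_inv -!mcompA (tl (esym (tsym_nat _ _))) -!mcompA.
congr (_ ∘ (_ ∘ _)); apply: (isom_monoL (i := tassoc Y X Z)).
by rewrite (tl (fwdK _)) mcomp1m !mcompA thexagon.
Qed.

Lemma tw_tw (X Y Z : T) (B : K) :
  tw (Y ⊗ Z) X B ∘ tw Z Y (A X B) =
  tassoc X Y Z ▷ B ∘ tw Z (X ⊗ Y) B ∘ Z ◁ tw Y X B.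
Proof.
apply: (isom_monoR (i := aassoc A Z Y (A X B))).
apply: (isom_monoR (i := aassoc A (Z ⊗ Y) X B)).
rewrite -!mcompA (tl (tw_aassoc _ _ _)) aassoc_natl (tl (tw_aassoc _ _ _)).
rewrite apentagon -!mcompA (tl (bmapr _ _ _ _)) tw_aassoc.
rewrite (tl (aassoc_natm _ _ _)) -!mcompA (tl (tw_aassoc _ _ _)) !bmapl.
by rewrite -tsym_tsym !mcompA.
Qed.

Context (asK : forall (X Y Z : T) (a b c : K),
  isom (A (X ⊗ Y) c ⊕ A Z (A X b ⊕ A Y a)) (A X (A Y c ⊕ A Z b) ⊕ A (Y ⊗ Z) a)).
Context (asK1 : forall (X Y Z : T) (a b c : K),
  asK X Y Z a b c ∘ in1 = in1 ∘ (X ◁ in1 ∘ aassoc A X Y c)).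
Context (asK2 : forall (X Y Z : T) (a b c : K),
  asK X Y Z a b c ∘ (in2 ∘ Z ◁ in1) = in1 ∘ (X ◁ in2 ∘ sw Z X b)).
Context (asK3 : forall (X Y Z : T) (a b c : K),
  asK X Y Z a b c ∘ (in2 ∘ Z ◁ in2) = in2 ∘ tw Z Y a).

Lemma asK2t (X Y Z : T) (a b c V : K) (h : mor V _) :
  asK X Y Z a b c ∘ (in2 ∘ (Z ◁ in1 ∘ h)) = in1 ∘ (X ◁ in2 ∘ (sw Z X b ∘ h)).
Proof. by rewrite (mcompA in2) (tl (asK2 _ _ _ _ _ _)) -!mcompA. Qed.

Lemma asK3t (X Y Z : T) (a b c V : K) (h : mor V _) :
  asK X Y Z a b c ∘ (in2 ∘ (Z ◁ in2 ∘ h)) = in2 ∘ (tw Z Y a ∘ h).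
Proof. by rewrite (mcompA in2) (tl (asK3 _ _ _ _ _ _)) -!mcompA. Qed.

Lemma aassoc_natr (X Y : T) (B B' : K) (h : mor B B') :
  aassoc A X Y B' ∘ (X ⊗ Y) ◁ h = X ◁ (Y ◁ h) ∘ aassoc A X Y B.
Proof. by rewrite aassoc_nat bmap1. Qed.

Lemma sw_natr (X Y : T) (B B' : K) (h : mor B B') :
  sw X Y B' ∘ X ◁ (Y ◁ h) = Y ◁ (X ◁ h) ∘ sw X Y B.
Proof. by rewrite sw_nat. Qed.

Lemma tw_natr (X Y : T) (B B' : K) (h : mor B B') :
  tw X Y B' ∘ X ◁ (Y ◁ h) = (Y ⊗ X) ◁ h ∘ tw X Y B.
Proof. by rewrite -tw_nat bmap1. Qed.

Lemma asK_pentagon (X Y Z W : T) (a b c d : K) :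
  asK X Y (Z ⊗ W) a b (A Z d ⊕ A W c) ∘ asK (X ⊗ Y) Z W (A X b ⊕ A Y a) c d =
  bipm (X ◁ asK Y Z W b c d) (tassoc Y Z W ▷ a) ∘
    asK X (Y ⊗ Z) W a (A Y c ⊕ A Z b) d ∘
    bipm (tassoc X Y Z ▷ d) (W ◁ asK X Y Z a b c).
Proof.
apply: bip_ext; last first; first (apply: act_ext; last apply: act_ext2);
  rewrite -!mcompA.
- rewrite asK2 (tl (asK1 _ _ _ _ _ _)) -!mcompA (tl (aassoc_natr _ _ _)).
  rewrite -!mcompA sw_tens (tl (bipm_in2 _ _)) -!mcompA bmapr asK1.
  rewrite -!bmapr asK2t (tl (sw_natr _ _ _)) (tl (bipm_in1 _ _)) -!mcompA.
  by rewrite (tl (bmapr _ _ _ in2)) (tl (bmapr _ _ _ (_ ◁ in1))) -mcompA asK2 -!bmapr -!mcompA.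
- rewrite asK3t tw_natr asK2t sw_tw (tl (bipm_in2 _ _)) -!mcompA.
  rewrite (tl (bmapr _ _ _ in2)) bmapr -mcompA asK2 -!bmapr asK2t.
  rewrite (tl (sw_natr _ _ _)) (tl (bipm_in1 _ _)) -!mcompA.
  by rewrite (tl (bmapr _ _ _ in2)) (tl (bmapr _ _ _ (_ ◁ in2))) -mcompA asK3 -!bmapr -!mcompA.
- rewrite asK3t tw_natr asK3t tw_tw (tl (bipm_in2 _ _)) -!mcompA.
  rewrite (tl (bmapr _ _ _ in2)) bmapr -mcompA asK3 -!bmapr asK3t.
  by rewrite (tl (bipm_in2 _ _)) -!mcompA.
rewrite asK1 (tl (asK1 _ _ _ _ _ _)) -!mcompA (tl (aassoc_natr _ _ _)).
rewrite -!mcompA apentagon bipm_in1 (tl (asK1 _ _ _ _ _ _)) -!mcompA.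
rewrite (tl (bipm_in1 _ _)) -!mcompA (tl (bmapr _ _ _ in1)) asK1 -!bmapr.
by rewrite -!mcompA.
Qed.

Lemma asK_nat (X X' Y Y' Z Z' : T) (a a' b b' c c' : K)
    (f : mor X X') (g : mor Y Y') (h : mor Z Z')
    (u : mor a a') (v : mor b b') (w : mor c c') :
  bipm (bmap A f (bipm (bmap A g w) (bmap A h v))) (bmap A (bmap (tens T) g h) u)
    ∘ asK X Y Z a b c =
  asK X' Y' Z' a' b' c' ∘
    bipm (bmap A (bmap (tens T) f g) w) (bmap A h (bipm (bmap A f v) (bmap A g u))).
Proof.
apply: bip_ext; last apply: act_ext; rewrite -!mcompA.
- rewrite asK1 bipm_in1 (tl (asK1 _ _ _ _ _ _)) -!mcompA (tl (bipm_in1 _ _)) -!mcompA.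
  by rewrite (tl (bmap_bipm_in1 _ _ _ _)) -!mcompA aassoc_nat.
- rewrite asK2 (tl (bipm_in2 _ _)) (tl (bipm_in1 _ _)) -!mcompA.
  by rewrite bmap_bipm_in1 (tl (bmap_bipm_in2 _ _ _ _)) asK2t -!mcompA sw_nat.
- rewrite asK3 (tl (bipm_in2 _ _)) (tl (bipm_in2 _ _)) -!mcompA.
  by rewrite bmap_bipm_in2 asK3t tw_nat.
Qed.

Lemma asK_hexagon (X Y Z : T) (a b c : K) :
  asK Y Z X b c a ∘ bipC_fwd (A X (A Y c ⊕ A Z b)) (A (Y ⊗ Z) a)
    ∘ asK X Y Z a b c =
  bipm (Y ◁ bipC_fwd (A X c) (A Z a)) (tsym X Z ▷ b) ∘ asK Y X Z b a c ∘
    bipm (tsym X Y ▷ c) (Z ◁ bipC_fwd (A X b) (A Y a)).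
Proof.
apply: bip_ext; last apply: act_ext; rewrite -!mcompA.
- rewrite asK1 (tl (bipC_in1 _ _)) asK2t bipm_in1 (tl (asK1 _ _ _ _ _ _)) -!mcompA.
  rewrite (tl (bipm_in1 _ _)) -!mcompA (tl (bmapr _ _ _ in1)) bipC_in1.
  by rewrite sw_aassoc.
- rewrite asK2 (tl (bipC_in1 _ _)) asK3t (tl (bipm_in2 _ _)) -!mcompA.
  rewrite bmapr bipC_in1 asK3 (tl (bipm_in2 _ _)) -!mcompA; congr (_ ∘ _).
  rewrite tsym_sw; apply: (isom_monoR (i := aassoc A Z X b)).
  by rewrite -mcompA sw_aassoc bwdK (tl (tw_aassoc _ _ _)) bmapl tsymK bmap1.
- rewrite asK3 (tl (bipC_in2 _ _)) (tl (asK1 _ _ _ _ _ _)) -!mcompA aassoc_tw.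
  rewrite (tl (bipm_in2 _ _)) -!mcompA bmapr bipC_in2 asK2.
  by rewrite (tl (bipm_in1 _ _)) -!mcompA (tl (bmapr _ _ _ in2)) bipC_in2.
Qed.

Lemma asK_triangle (X Y : T) (a b : K) :
  bipm (X ◁ (aunit A b ∘ pr1)) (tlunit Y ▷ a) ∘ asK X (tunit T) Y a (zob K) b =
  bipm (trunit X ▷ b) (Y ◁ (aunit A a ∘ pr2)).
Proof.
apply: bip_ext; last apply: act_ext; rewrite -!mcompA.
- rewrite asK1 bipm_in1 (tl (bipm_in1 _ _)) -!mcompA (tl (bmapr _ _ _ in1)).
  by rewrite -mcompA pr1in1 mcompm1 atriangle.
- rewrite asK2 (tl (bipm_in1 _ _)) (tl (bipm_in2 _ _)) -!mcompA.
  rewrite (tl (bmapr _ _ _ in2)) bmapr -!mcompA !bipE.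
  by rewrite !bmap0r !bipE.
- rewrite asK3 (tl (bipm_in2 _ _)) (tl (bipm_in2 _ _)) -!mcompA.
  rewrite bmapr -!mcompA pr2in2 mcompm1; congr (_ ∘ _).
  apply: (isom_monoR (i := aassoc A Y (tunit T) a)).
  by rewrite -mcompA tw_aassoc bmapl tsym_unit atriangle.
Qed.

End Coherence.

(* Z * (Y * B) -> (Y ⊗ Z) * B *)
Definition tw (Z Y : T) (B : K) : isom (A Z (A Y B)) (A (Y ⊗ Z) B) :=
  isom_comp (bmap_isom A (tsym Z Y) (isom_id B)) (isom_inv (aassoc A Z Y B)).

(* Z * (Y * B) -> Y * (Z * B) *)
Definition sw (Z Y : T) (B : K) : isom (A Z (A Y B)) (A Y (A Z B)) :=
  isom_comp (aassoc A Y Z B) (tw Z Y B).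



Definition assocK (X Y Z : T) (a b c : K) :
    isom (A (X ⊗ Y) c ⊕ A Z (A X b ⊕ A Y a)) (A X (A Y c ⊕ A Z b) ⊕ A (Y ⊗ Z) a) :=
  bip_assoc (aassoc A X Y c) (sw Z X b) (tw Z Y a).

Lemma tw_aassoc (Z Y : T) (B : K) : tw Z Y B ∘ aassoc A Z Y B = tsym Z Y ▷ B.
Proof. by rewrite /= -mcompA bwdK mcompm1. Qed.

Lemma sw_aassoc (Z Y : T) (B : K) :
  sw Z Y B ∘ aassoc A Z Y B = aassoc A Y Z B ∘ tsym Z Y ▷ B.
Proof. by rewrite -tw_aassoc mcompA. Qed.

Lemma assocK1 (X Y Z : T) (a b c : K) :
  assocK X Y Z a b c ∘ in1 = in1 ∘ (X ◁ in1 ∘ aassoc A X Y c).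
Proof. by rewrite bip_assoc_in1 mcompA. Qed.

Lemma assocK2 (X Y Z : T) (a b c : K) :
  assocK X Y Z a b c ∘ (in2 ∘ Z ◁ in1) = in1 ∘ (X ◁ in2 ∘ sw Z X b).
Proof. by rewrite mcompA bip_assoc_in21 mcompA. Qed.

Lemma assocK3 (X Y Z : T) (a b c : K) :
  assocK X Y Z a b c ∘ (in2 ∘ Z ◁ in2) = in2 ∘ tw Z Y a.
Proof. by rewrite mcompA bip_assoc_in22. Qed.

Program Definition ext_tens :
    bifunctor (prodT T K) (prodT T K) (prodT T K) :=
  @Bifunctor (prodT T K) (prodT T K) (prodT T K)
    (fun P Q => (P.1 ⊗ Q.1, A P.1 Q.2 ⊕ A Q.1 P.2))
    (fun _ _ _ _ f g =>
       (bmap (tens T) f.1 g.1, bipm (bmap A f.1 g.2) (bmap A g.1 f.2)))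
    _ _ _ _.
Next Obligation. by move=> P Q /=; rewrite !bmap1 bipm1. Qed.
Next Obligation. by move=> * /=; rewrite !bmapC bipmC. Qed.
Next Obligation. by move=> * /=; rewrite !bmapDl bmapDr bipmD. Qed.
Next Obligation. by move=> * /=; rewrite !bmapDr bmapDl bipmD. Qed.

Lemma ext_tens_tri :
  bi_triangulated (C := prodT T K) (D := prodT T K) (E := prodT T K) ext_tens.
Proof.
have [tl tr] := tens_tri T; have [al ar] := ttact_tri A; split=> P.
  apply: (@pairF_tri (prodT T K) T K (compF (fixl (tens T) P.1) (fstF T K))
    (sumF (compF (fixl A P.1) (sndF T K)) (compF (fixr A P.2) (fstF T K)))).
    exact: compF_tri (tl _) (fstF_tri _ _).
  apply: (@sumF_tri (prodT T K) K).
    exact: compF_tri (al _) (sndF_tri _ _).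
  exact: compF_tri (ar _) (fstF_tri _ _).
apply: (@pairF_tri (prodT T K) T K (compF (fixr (tens T) P.1) (fstF T K))
  (sumF (compF (fixr A P.2) (fstF T K)) (compF (fixl A P.1) (sndF T K)))).
  exact: compF_tri (tr _) (fstF_tri _ _).
apply: (@sumF_tri (prodT T K) K).
  exact: compF_tri (ar _) (fstF_tri _ _).
exact: compF_tri (al _) (sndF_tri _ _).
Qed.

Lemma act_zob (X : T) : idm (A X (zob K)) = 0.
Proof. by rewrite -bmap1 zobP bmap0r. Qed.

Lemma in1pr1 (X Z : K) : idm Z = 0 -> in1 ∘ pr1 = idm (X ⊕ Z).
Proof.
move=> z; rewrite -bip_id -[pr2]mcomp1m z mcomp0m.
by rewrite mcompm0 addr0.
Qed.

Lemma in2pr2 (X Z : K) : idm Z = 0 -> in2 ∘ pr2 = idm (Z ⊕ X).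
Proof.
move=> z; rewrite -bip_id -[pr1]mcomp1m z mcomp0m.
by rewrite mcompm0 add0r.
Qed.

Definition ext_unit : prodT T K := (tunit T, zob K).

Definition ext_assoc (P Q R : prodT T K) :
    isom (ext_tens (ext_tens P Q) R) (ext_tens P (ext_tens Q R)) :=
  @pair_isom T K (ext_tens (ext_tens P Q) R) (ext_tens P (ext_tens Q R))
    (tassoc P.1 Q.1 R.1) (assocK P.1 Q.1 R.1 P.2 Q.2 R.2).

Definition ext_lunit (P : prodT T K) : isom (ext_tens ext_unit P) P :=
  @pair_isom T K (ext_tens ext_unit P) P (tlunit P.1)
    (isom_comp (aunit A P.2) (Isom (in1pr1 _ (act_zob P.1)) (pr1in1 _ _))).

Definition ext_runit (P : prodT T K) : isom (ext_tens P ext_unit) P :=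
  @pair_isom T K (ext_tens P ext_unit) P (trunit P.1)
    (isom_comp (aunit A P.2) (Isom (in2pr2 _ (act_zob P.1)) (pr2in2 _ _))).

Definition ext_sym (P Q : prodT T K) : isom (ext_tens P Q) (ext_tens Q P) :=
  @pair_isom T K (ext_tens P Q) (ext_tens Q P)
    (tsym P.1 Q.1) (bipC (A P.1 Q.2) (A Q.1 P.2)).

Lemma ext_mor_eq (P Q : prodT T K) (f g : mor P Q) :
  f.1 = g.1 -> f.2 = g.2 -> f = g.
Proof. by move: f g => [f1 f2] [g1 g2] /= -> ->. Qed.

Lemma ext_assoc_nat (P P' Q Q' R R' : prodT T K)
    (f : mor P P') (g : mor Q Q') (h : mor R R') :
  bmap ext_tens f (bmap ext_tens g h) ∘ ext_assoc P Q R =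
  ext_assoc P' Q' R' ∘ bmap ext_tens (bmap ext_tens f g) h.
Proof.
apply: ext_mor_eq; first exact: tassoc_nat.
exact: (asK_nat tw_aassoc sw_aassoc assocK1 assocK2 assocK3).
Qed.

Lemma ext_lunit_nat (P P' : prodT T K) (f : mor P P') :
  f ∘ ext_lunit P = ext_lunit P' ∘ bmap ext_tens (idm ext_unit) f.
Proof.
apply: ext_mor_eq; first exact: tlunit_nat.
by rewrite /= mcompA aunit_nat -!mcompA pr1_bipm.
Qed.

Lemma ext_runit_nat (P P' : prodT T K) (f : mor P P') :
  f ∘ ext_runit P = ext_runit P' ∘ bmap ext_tens f (idm ext_unit).
Proof.
apply: ext_mor_eq; first exact: trunit_nat.
by rewrite /= mcompA aunit_nat -!mcompA pr2_bipm.
Qed.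

Lemma ext_sym_nat (P P' Q Q' : prodT T K) (f : mor P P') (g : mor Q Q') :
  bmap ext_tens g f ∘ ext_sym P Q = ext_sym P' Q' ∘ bmap ext_tens f g.
Proof.
apply: ext_mor_eq; first exact: tsym_nat.
apply: bip_ext; rewrite /= -!mcompA.
  by rewrite bipC_in1 !bipm_in1 bipm_in2 mcompA bipC_in1.
by rewrite bipC_in2 !bipm_in2 bipm_in1 mcompA bipC_in2.
Qed.

Lemma ext_pentagon (P Q R S : prodT T K) :
  ext_assoc P Q (ext_tens R S) ∘ ext_assoc (ext_tens P Q) R S =
  bmap ext_tens (idm P) (ext_assoc Q R S) ∘ ext_assoc P (ext_tens Q R) S
    ∘ bmap ext_tens (ext_assoc P Q R) (idm S).
Proof.
apply: ext_mor_eq; first exact: tpentagon.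
exact: (asK_pentagon tw_aassoc sw_aassoc assocK1 assocK2 assocK3).
Qed.

Lemma ext_triangle (P Q : prodT T K) :
  bmap ext_tens (idm P) (ext_lunit Q) ∘ ext_assoc P ext_unit Q =
  bmap ext_tens (ext_runit P) (idm Q).
Proof.
apply: ext_mor_eq; first exact: ttriangle.
exact: (asK_triangle tw_aassoc assocK1 assocK2 assocK3).
Qed.

Lemma ext_symK (P Q : prodT T K) : ext_sym Q P ∘ ext_sym P Q = idm (ext_tens P Q).
Proof. by apply: ext_mor_eq; [exact: tsymK | exact: bipC_K]. Qed.

Lemma ext_sym_unit (P : prodT T K) :
  ext_lunit P ∘ ext_sym P ext_unit = ext_runit P.
Proof.
apply: ext_mor_eq; first exact: tsym_unit.
rewrite /= -mcompA; congr (_ ∘ _).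
by rewrite /bipC_fwd mcompDr !bipE.
Qed.

Lemma ext_hexagon (P Q R : prodT T K) :
  ext_assoc Q R P ∘ ext_sym P (ext_tens Q R) ∘ ext_assoc P Q R =
  bmap ext_tens (idm Q) (ext_sym P R) ∘ ext_assoc Q P R
    ∘ bmap ext_tens (ext_sym P Q) (idm R).
Proof.
apply: ext_mor_eq; first exact: thexagon.
exact: (asK_hexagon tw_aassoc sw_aassoc assocK1 assocK2 assocK3).
Qed.

Definition trivial_extension : ttCat :=
  @TTCat (prodT T K) ext_tens ext_tens_tri ext_unit ext_assoc ext_lunit
    ext_runit ext_sym ext_assoc_nat ext_lunit_nat ext_runit_nat ext_sym_nat
    ext_pentagon ext_triangle ext_symK ext_sym_unit ext_hexagon.

End TrivialExtension.

(* Mod C: the additive functors C^op -> Ab. *)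
Record Mod (C : addCat) := MkMod {
  mod_ob :> C -> abGrp;
  res : forall X Y : C, mor X Y -> mod_ob Y -> mod_ob X;
  res1 : forall X (x : mod_ob X), res (idm X) x = x;
  resC : forall X Y Z (g : mor Y Z) (f : mor X Y) (x : mod_ob Z),
    res (g ∘ f) x = res f (res g x);
  res_add : forall X Y (f : mor X Y) (x y : mod_ob Y),
    res f (x + y) = res f x + res f y;
  res_Dl : forall X Y (f g : mor X Y) (x : mod_ob Y),
    res (f + g) x = res f x + res g x }.

Record modMor (C : addCat) (M N : Mod C) := ModMor {
  mod_fun :> forall X : C, M X -> N X;
  mod_funD : forall X (x y : M X), mod_fun (x + y) = mod_fun x + mod_fun y;
  mod_fun_nat : forall X Y (f : mor X Y) (x : M Y),
    mod_fun (res f x) = res f (mod_fun x) }.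

Definition yoneda (C : addCat) (X : C) : Mod C :=
  @MkMod C (fun Z => mor Z X) (fun _ _ f u => u ∘ f)
    (fun Z u => mcompm1 u) (fun _ _ _ g f u => mcompA u g f)
    (fun _ _ f u v => mcompDl u v f) (fun _ _ f g u => mcompDr u f g).

(* Kernels and cokernels in Mod C are computed objectwise. *)
Definition mod_mono (C : addCat) (M N : Mod C) (i : modMor M N) : Prop :=
  forall X, injective (i X).

Definition mod_epi (C : addCat) (M N : Mod C) (p : modMor M N) : Prop :=
  forall X (y : N X), exists x, p X x = y.

Definition mod_exact (C : addCat) (L M N : Mod C) (f : modMor L M)
    (g : modMor M N) : Prop :=
  forall X (y : M X), g X y = 0 <-> exists x, f X x = y.

Definition yoneda_mor (C : addCat) (X Y : C) (f : mor X Y) :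
    modMor (yoneda X) (yoneda Y) :=
  @ModMor C (yoneda X) (yoneda Y) (fun _ u => f ∘ u)
    (fun _ u v => mcompDr f u v) (fun _ _ g u => mcompA f u g).

(* Finite sums of representables being representable, M is finitely presented
   when there is an exact sequence yoneda X -> yoneda Y -> M -> 0; by the
   Yoneda lemma the first map comes from a morphism X -> Y. *)
Definition fin_pres (C : addCat) (M : Mod C) : Prop :=
  exists (X Y : C) (f : mor X Y) (p : modMor (yoneda Y) M),
    mod_epi p /\ mod_exact (yoneda_mor f) p.

(* Day convolution: (M ⊗ N) Z is the coend of M X ⊗ N Y ⊗ Hom (Z, X ⊗ Y) over
   X and Y, presented as the group of formal sums of generators (x, y, f) with
   x in M X, y in N Y and f : Z -> X ⊗ Y, modulo additivity in each of x, y, f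
   and the relations (res a x, res b y, f) = (x, y, (a ⊗ b) ∘ f).  The inverse
   of (x, y, f) is (- x, y, f), so formal sums without signs suffice. *)
Record day_gen (T : ttCat) (M N : Mod T) (Z : T) := DayGen {
  day_X : T;
  day_Y : T;
  day_x : M day_X;
  day_y : N day_Y;
  day_f : mor Z (tens T day_X day_Y) }.
Arguments DayGen {T M N Z day_X day_Y}.

Inductive day_rel (T : ttCat) (M N : Mod T) (Z : T) :
    seq (day_gen M N Z) -> seq (day_gen M N Z) -> Prop :=
| day_refl s : day_rel s s
| day_sym s t : day_rel s t -> day_rel t s
| day_trans s t u : day_rel s t -> day_rel t u -> day_rel s u
| day_cat s s' t t' : day_rel s s' -> day_rel t t' ->
    day_rel (s ++ t) (s' ++ t')
| day_catC s t : day_rel (s ++ t) (t ++ s)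
| day_zero X Y (y : N Y) (f : mor Z (tens T X Y)) :
    day_rel [:: DayGen 0 y f] [::]
| day_addx X Y (x x' : M X) (y : N Y) (f : mor Z (tens T X Y)) :
    day_rel [:: DayGen (x + x') y f] [:: DayGen x y f; DayGen x' y f]
| day_addy X Y (x : M X) (y y' : N Y) (f : mor Z (tens T X Y)) :
    day_rel [:: DayGen x (y + y') f] [:: DayGen x y f; DayGen x y' f]
| day_addf X Y (x : M X) (y : N Y) (f f' : mor Z (tens T X Y)) :
    day_rel [:: DayGen x y (f + f')] [:: DayGen x y f; DayGen x y f']
| day_res X X' Y Y' (a : mor X' X) (b : mor Y' Y) (x : M X) (y : N Y)
      (f : mor Z (tens T X' Y')) :
    day_rel [:: DayGen (res a x) (res b y) f]
            [:: DayGen x y (bmap (tens T) a b ∘ f)].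

Section Day.
Context (T : ttCat) (M N : Mod T).

Definition day_sort (Z : T) : Type :=
  {P : seq (day_gen M N Z) -> Prop | exists s, P = day_rel s}.

Definition day_class (Z : T) (s : seq (day_gen M N Z)) : day_sort Z :=
  exist _ (day_rel s) (ex_intro _ s erefl).

Definition day_repr (Z : T) (c : day_sort Z) : seq (day_gen M N Z) :=
  sval (cid (svalP c)).

Lemma day_reprK (Z : T) (c : day_sort Z) : day_class (day_repr c) = c.
Proof.
rewrite /day_repr; case: cid => s /= e; case: c e => P p /= e.
by rewrite /day_class; apply: eq_exist.
Qed.

Lemma day_classP (Z : T) (s t : seq (day_gen M N Z)) :
  day_class s = day_class t <-> day_rel s t.
Proof.
split=> [/(congr1 sval) /= ->|r]; first exact: day_refl.
apply: eq_exist; apply/funext => u; apply/propext; split=> h.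
  exact: day_trans (day_sym r) h.
exact: day_trans r h.
Qed.

Definition day_zero_cl (Z : T) : day_sort Z := day_class [::].

Definition day_add (Z : T) (c d : day_sort Z) : day_sort Z :=
  day_class (day_repr c ++ day_repr d).

Definition day_oppg (Z : T) (g : day_gen M N Z) : day_gen M N Z :=
  DayGen (- day_x g) (day_y g) (day_f g).

Definition day_opp (Z : T) (c : day_sort Z) : day_sort Z :=
  day_class (map (@day_oppg Z) (day_repr c)).

Definition day_resg (Z W : T) (h : mor W Z) (g : day_gen M N Z) : day_gen M N W :=
  DayGen (day_x g) (day_y g) (day_f g ∘ h).

Definition day_restr (Z W : T) (h : mor W Z) (c : day_sort Z) : day_sort W :=
  day_class (map (day_resg h) (day_repr c)).

Lemma day_repr_class (Z : T) (s : seq (day_gen M N Z)) :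
  day_rel (day_repr (day_class s)) s.
Proof. by apply/day_classP; rewrite day_reprK. Qed.

Lemma day_addE (Z : T) (s t : seq (day_gen M N Z)) :
  day_add (day_class s) (day_class t) = day_class (s ++ t).
Proof. by apply/day_classP; apply: day_cat; exact: day_repr_class. Qed.

Lemma day_ind (Z : T) (P : day_sort Z -> Prop) :
  (forall s, P (day_class s)) -> forall c, P c.
Proof. by move=> h c; rewrite -(day_reprK c). Qed.

Lemma day_addA (Z : T) : associative (@day_add Z).
Proof.
move=> c d e; elim/day_ind: c => s; elim/day_ind: d => t; elim/day_ind: e => u.
by rewrite !day_addE catA.
Qed.

Lemma day_addC (Z : T) : commutative (@day_add Z).
Proof.
move=> c d; elim/day_ind: c => s; elim/day_ind: d => t.
by rewrite !day_addE; apply/day_classP/day_catC.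
Qed.

Lemma day_add0 (Z : T) : left_id (day_zero_cl Z) (@day_add Z).
Proof. by elim/day_ind => s; rewrite day_addE. Qed.

Lemma day_oppg_rel (Z : T) (g : day_gen M N Z) : day_rel [:: day_oppg g; g] [::].
Proof.
case: g => X Y x y f; apply: day_trans (day_zero M y f).
by rewrite -(addNr x); apply/day_sym/day_addx.
Qed.

Lemma day_addN (Z : T) : left_inverse (day_zero_cl Z) (@day_opp Z) (@day_add Z).
Proof.
move=> c; rewrite -[X in day_add _ X]day_reprK day_addE; apply/day_classP.
elim: (day_repr c) => [|g s IHs] /=; first exact: day_refl.
have h := day_cat (day_cat (day_refl [:: day_oppg g])
  (day_catC (map (@day_oppg Z) s) [:: g])) (day_refl s).
apply: day_trans (_ : day_rel _ ([:: day_oppg g; g] ++ (map (@day_oppg Z) s ++ s))) _.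
  by move: h; rewrite -!catA.
exact: (day_cat (day_oppg_rel g) IHs).
Qed.

Definition day_grp (Z : T) : abGrp :=
  AbGrp (@day_addA Z) (@day_addC Z) (@day_add0 Z) (@day_addN Z).

Lemma day_restr_rel (Z W : T) (h : mor W Z) (s t : seq (day_gen M N Z)) :
  day_rel s t -> day_rel (map (day_resg h) s) (map (day_resg h) t).
Proof.
elim=> {s t}; try by move=> *; constructor.
- by move=> s t u _ st _ tu; exact: day_trans st tu.
- by move=> s s' t t' _ ss _ tt; rewrite !map_cat; exact: day_cat.
- by move=> s t; rewrite !map_cat; exact: day_catC.
- by move=> X Y x y f f'; rewrite /= /day_resg /= mcompDl; exact: day_addf.
- by move=> X X' Y Y' a b x y f; rewrite /= /day_resg /= -mcompA; exact: day_res.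
Qed.

Lemma day_restrE (Z W : T) (h : mor W Z) (s : seq (day_gen M N Z)) :
  day_restr h (day_class s) = day_class (map (day_resg h) s).
Proof. by apply/day_classP/day_restr_rel/day_repr_class. Qed.

Lemma day_restr1 (Z : T) (c : day_grp Z) : day_restr (idm Z) c = c.
Proof.
elim/day_ind: c => s; rewrite day_restrE; congr day_class.
rewrite -[RHS]map_id; apply: eq_map => -[X Y x y f].
by rewrite /day_resg /= mcompm1.
Qed.

Lemma day_restrC (X Y Z : T) (g : mor Y Z) (f : mor X Y) (c : day_grp Z) :
  day_restr (g ∘ f) c = day_restr f (day_restr g c).
Proof.
elim/day_ind: c => s; rewrite !day_restrE -map_comp; congr day_class.
by apply: eq_map => -[U V x y h]; rewrite /day_resg /= mcompA.
Qed.

Lemma day_restr_add (X Y : T) (f : mor X Y) (c d : day_grp Y) :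
  day_restr f (c + d) = (day_restr f c : day_grp X) + day_restr f d.
Proof.
elim/day_ind: c => s; elim/day_ind: d => t.
rewrite -[LHS]/(day_restr f (day_add _ _)) -[RHS]/(day_add _ _).
by rewrite day_addE !day_restrE day_addE map_cat.
Qed.

Lemma day_restr_Dl (X Y : T) (f g : mor X Y) (c : day_grp Y) :
  day_restr (f + g) c = (day_restr f c : day_grp X) + day_restr g c.
Proof.
elim/day_ind: c => s; rewrite -[RHS]/(day_add _ _) !day_restrE day_addE.
apply/day_classP; elim: s => [|[U V x y h] s IHs] /=; first exact: day_refl.
set u := day_resg f _; set v := day_resg g _.
apply: day_trans (_ : day_rel _ ([:: u; v] ++ (map (day_resg f) s ++ map (day_resg g) s))) _.
  rewrite -cat1s; apply: day_cat IHs.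
  by rewrite /u /v /day_resg /= mcompDr; exact: day_addf.
have := day_cat (day_cat (day_refl [:: u])
  (day_catC [:: v] (map (day_resg f) s))) (day_refl (map (day_resg g) s)).
by rewrite -!catA.
Qed.

Definition day : Mod T :=
  @MkMod T day_grp (fun X Y h => day_restr h) day_restr1 day_restrC
    day_restr_add day_restr_Dl.

End Day.

(* Serre subcategories of mod T, given as classes of objects of Mod T. *)
Record is_serre (C : addCat) (B : Mod C -> Prop) : Prop := IsSerre {
  serre_fp : forall M, B M -> fin_pres M;
  serre_ne : exists M, B M;
  serre_sub : forall (M N : Mod C) (i : modMor M N),
    mod_mono i -> fin_pres M -> B N -> B M;
  serre_quo : forall (M N : Mod C) (p : modMor M N),
    mod_epi p -> fin_pres N -> B M -> B N;
  serre_ext : forall (L M N : Mod C) (i : modMor L M) (p : modMor M N),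
    mod_mono i -> mod_exact i p -> mod_epi p ->
    fin_pres M -> B L -> B N -> B M }.

Definition is_serre_ideal (T : ttCat) (B : Mod T -> Prop) : Prop :=
  is_serre B /\ forall M N : Mod T, fin_pres M -> B N -> B (day M N).

Definition is_proper (C : addCat) (B : Mod C -> Prop) : Prop :=
  exists M : Mod C, fin_pres M /\ ~ B M.

Definition is_maximal_serre_ideal (T : ttCat) (B : Mod T -> Prop) : Prop :=
  [/\ is_serre_ideal B, is_proper B &
    forall B' : Mod T -> Prop, is_serre_ideal B' -> is_proper B' ->
      (forall M, B M -> B' M) -> forall M, B' M -> B M].

Record Spch (T : ttCat) := MkSpch {
  spch_ideal :> Mod T -> Prop;
  spch_maximal : is_maximal_serre_ideal spch_ideal }.

HB.instance Definition _ (T : ttCat) := gen_eqMixin (Spch T).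
HB.instance Definition _ (T : ttCat) := gen_choiceMixin (Spch T).

Local Open Scope classical_set_scope.

Definition supph (T : ttCat) (X : T) : set (Spch T) :=
  [set B : Spch T | ~ B (yoneda X)].

Definition spch_open (T : ttCat) : set_system (Spch T) :=
  [set U | exists D : set T, U = \bigcup_(X in D) ~` supph X].

Lemma supphC (T : ttCat) (X : T) (B : Spch T) : (~` supph X) B <-> B (yoneda X).
Proof. by rewrite /supph /setC /=; split=> [/contrapT|? ?]. Qed.

Lemma fin_pres_yoneda (C : addCat) (X : C) : fin_pres (yoneda X).
Proof.
exists (zob C), X, 0; exists (@ModMor C (yoneda X) (yoneda X) (fun _ u => u)
  (fun _ _ _ => erefl) (fun _ _ _ _ => erefl)); split=> [Z u|Z u]; first by exists u.
split=> /= [->|[v <-]]; first by exists 0; rewrite mcompm0.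
by rewrite mcomp0m.
Qed.

Lemma serre_zob (C : addCat) (B : Mod C -> Prop) : is_serre B ->
  B (yoneda (zob C)).
Proof.
move=> sB; have [M BM] := serre_ne sB.
have z0 Z (u v : mor Z (zob C)) : u = v by rewrite (zero_in u) (zero_in v).
apply: (serre_quo sB (p := @ModMor C M (yoneda (zob C)) (fun _ _ => 0)
  (fun _ _ _ => z0 _ _ _) (fun _ _ _ _ => z0 _ _ _))) BM.
  by move=> Z u; exists (0 : M Z); exact: z0.
exact: fin_pres_yoneda.
Qed.

Lemma serre_bip (C : addCat) (B : Mod C -> Prop) (X Y : C) : is_serre B ->
  B (yoneda (X ⊕ Y)%cat) <-> B (yoneda X) /\ B (yoneda Y).
Proof.
move=> sB; have fp := fin_pres_yoneda; split=> [BXY|[BX BY]].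
  split.
    apply: (serre_quo sB (p := yoneda_mor pr1)) BXY => // Z u.
    by exists (in1 ∘ u)%cat; rewrite /= mcompA pr1in1 mcomp1m.
  apply: (serre_quo sB (p := yoneda_mor pr2)) BXY => // Z u.
  by exists (in2 ∘ u)%cat; rewrite /= mcompA pr2in2 mcomp1m.
apply: (serre_ext sB (i := yoneda_mor in1) (p := yoneda_mor pr2)) BX BY => //.
- by move=> Z u v /(congr1 (mcomp pr1)); rewrite /= !pr1in1K.
- move=> Z u; split=> /= [u0|[v <-]]; last by rewrite pr2in1K.
  exists (pr1 ∘ u)%cat; rewrite -[RHS]mcomp1m -bip_id mcompDl -!mcompA u0.
  by rewrite mcompm0 addr0.
- by move=> Z u; exists (in2 ∘ u)%cat; rewrite /= pr2in2K.
Qed.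

Lemma spch_openT (T : ttCat) : spch_open (@setT (Spch T)).
Proof.
exists [set zob T]; rewrite bigcup_set1; apply/seteqP; split=> // B _.
by apply: (proj2 (supphC _ _)); apply: serre_zob; case: (spch_maximal B) => -[].
Qed.

Lemma spch_openI (T : ttCat) : setI_closed (@spch_open T).
Proof.
move=> _ _ [D ->] [E ->].
exists [set Z | exists X Y, [/\ D X, E Y & Z = (X ⊕ Y)%cat]].
have sB (B : Spch T) : is_serre B by case: (spch_maximal B) => -[].
apply/seteqP; split=> B.
  move=> [[X DX /supphC BX] [Y EY /supphC BY]]; exists (X ⊕ Y)%cat.
    by exists X, Y.
  by apply/supphC/(serre_bip _ _ (sB B)).
move=> [_ [X [Y [DX EY ->]]] /supphC/(serre_bip _ _ (sB B))[BX BY]].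
by split; [exists X|exists Y] => //; apply/supphC.
Qed.

Lemma spch_open_bigU (T : ttCat) (I : Type) (f : I -> set (Spch T)) :
  (forall i, spch_open (f i)) -> spch_open (\bigcup_i f i).
Proof.
move=> /choice[D fD]; exists (\bigcup_i D i).
by rewrite bigcup_bigcup; apply: eq_bigcupr => i _; rewrite fD.
Qed.

HB.instance Definition _ (T : ttCat) :=
  isOpenTopological.Build (Spch T) (@spch_openT T) (@spch_openI T)
    (@spch_open_bigU T).

Lemma spch_closedE (T : ttCat) (F : set (Spch T)) :
  closed F <-> exists D : set T, F = \bigcap_(X in D) supph X.
Proof.
split=> [/closed_openC[D e]|[D ->]].
  by exists D; rewrite -[LHS]setCK e setC_bigcup; under eq_bigcapr do rewrite setCK.
by rewrite -openC; exists D; rewrite setC_bigcap.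
Qed.

Definition homeomorphic (X Y : topologicalType) : Prop :=
  exists (f : X -> Y) (g : Y -> X),
    [/\ cancel f g, cancel g f, continuous f & continuous g].

(* Main.v *)
(* The functors [fst : T ⋉ K -> T] and [X |-> (X, 0)] are adjoint to each other on
   both sides and monoidal.  Pulling modules back along either of them is exact,
   preserves finite presentation and turns Serre ideals into Serre ideals.  Let f
   and g be the resulting monotone maps from Serre ideals of mod (T ⋉ K) to those
   of mod T and back.  Then f (g C) = C, and B is contained in g (f B) since
   every module M over T ⋉ K surjects onto its T-part; both maps preserve
   properness, hence they restrict to inverse bijections between maximal ideals.
   They exchange the basic closed sets because pullbacks of representables are
   representable. *)
Require Import Defs.
From mathcomp Require Import all_boot classical_sets topology_structure.
From mathcomp Require Import all_algebra boolp.

Set Implicit Arguments.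
Unset Strict Implicit.
Unset Printing Implicit Defensive.

Import GRing.Theory.
Local Open Scope ring_scope.
Local Open Scope cat_scope.

(** * Elementary facts on zero objects, modules and their morphisms *)

Lemma zero_out (C : addCat) (X : C) (f : mor (zob C) X) : f = 0.
Proof. by rewrite -(mcompm1 f) zobP mcompm0. Qed.

Lemma res0 (C : addCat) (M : Mod C) (X Y : C) (f : mor X Y) : res f (0 : M Y) = 0.
Proof. by apply: (addrI (res f 0)); rewrite -res_add !addr0. Qed.

Section ModMorTheory.
Context (C : addCat) (M N : Mod C) (p : modMor M N).

Lemma mod_fun0 X : p X 0 = 0.
Proof. by apply: (addrI (p X 0)); rewrite -mod_funD !addr0. Qed.

Lemma mod_funN X (x : M X) : p X (- x) = - p X x.
Proof. by apply: (addrI (p X x)); rewrite -mod_funD !subrr mod_fun0. Qed.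

Lemma mod_funB X (x y : M X) : p X (x - y) = p X x - p X y.
Proof. by rewrite mod_funD mod_funN. Qed.

End ModMorTheory.

Lemma yoneda_lemma (C : addCat) (M : Mod C) (X Z : C) (p : modMor (yoneda X) M)
    (u : mor Z X) : p Z u = res u (p X (idm X)).
Proof. by rewrite -mod_fun_nat /= mcomp1m. Qed.

(** * Finite presentation of Day convolutions *)

Lemma day_gen0r (T : ttCat) (M N : Mod T) (X Y Z : T) (x : M X)
    (f : mor Z (tens T X Y)) :
  day_class [:: DayGen x (0 : N Y) f] = 0 :> day_grp M N Z.
Proof.
apply: (@addrI (day_grp M N Z) (day_class [:: DayGen x (0 : N Y) f])).
rewrite addr0 -[LHS]/(day_add _ _) day_addE; apply/day_classP/day_sym.
by rewrite -{1}(addr0 (0 : N Y)); exact: day_addy.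
Qed.

Section DayFinPres.
Context (T : ttCat) (M N : Mod T).
Context (X Y X' Y' : T) (f : mor X Y) (f' : mor X' Y').
Context (p : modMor (yoneda Y) M) (q : modMor (yoneda Y') N).
Hypotheses (pE : mod_epi p) (pX : mod_exact (yoneda_mor f) p).
Hypotheses (qE : mod_epi q) (qX : mod_exact (yoneda_mor f') q).

(** The usual presentation of a tensor product of cokernels: coker [f] ⊗ coker [f'] is the cokernel
    of ([f] ⊗ 1, 1 ⊗ [f']). *)
Definition day_pres_rel :
    mor (tens T X Y' ⊕ tens T Y X') (tens T Y Y') :=
  bmap (tens T) f (idm Y') ∘ pr1 + bmap (tens T) (idm Y) f' ∘ pr2.

Definition in_rel (Z : T) (u : mor Z (tens T Y Y')) : Prop :=
  exists v, day_pres_rel ∘ v = u.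

Lemma in_rel0 Z : in_rel (0 : mor Z _).
Proof. by exists 0; rewrite mcompm0. Qed.

Lemma in_relD Z (u v : mor Z _) : in_rel u -> in_rel v -> in_rel (u + v).
Proof. by move=> [a <-] [b <-]; exists (a + b); rewrite mcompDr. Qed.

Lemma in_relN Z (u : mor Z _) : in_rel u -> in_rel (- u).
Proof. by move=> [a <-]; exists (- a); rewrite mcompmN. Qed.

Lemma in_rel_comp Z W (u : mor Z _) (h : mor W Z) : in_rel u -> in_rel (u ∘ h).
Proof. by move=> [a <-]; exists (a ∘ h); rewrite mcompA. Qed.

Lemma in_rel_l U V (a : mor U Y) (b : mor V Y') :
  p U a = 0 -> in_rel (bmap (tens T) a b).
Proof.
move=> /pX[v <-]; exists (in1 ∘ bmap (tens T) v b).
by rewrite /day_pres_rel mcompDl -!mcompA !bipE -bmapC mcomp1m.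
Qed.

Lemma in_rel_r U V (a : mor U Y) (b : mor V Y') :
  q V b = 0 -> in_rel (bmap (tens T) a b).
Proof.
move=> /qX[v <-]; exists (in2 ∘ bmap (tens T) a v).
by rewrite /day_pres_rel mcompDl -!mcompA !bipE -bmapC mcomp1m.
Qed.

(** Write the difference as (a - a') ⊗ b + a' ⊗ (b - b'); by exactness each term factors through [f]
    or [f']. *)
Lemma in_relB U V (a a' : mor U Y) (b b' : mor V Y') :
  p U a = p U a' -> q V b = q V b' ->
  in_rel (bmap (tens T) a b - bmap (tens T) a' b').
Proof.
move=> ea eb.
have -> : bmap (tens T) a b - bmap (tens T) a' b' =
    bmap (tens T) (a - a') b + bmap (tens T) a' (b - b').
  apply: (addIr (bmap (tens T) a' b')); rewrite subrK -addrA -bmapDr subrK.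
  by rewrite -bmapDl subrK.
by apply: in_relD; [apply: in_rel_l|apply: in_rel_r]; rewrite mod_funB ?ea ?eb subrr.
Qed.

(** Chosen preimages, with no additivity or naturality; [in_relB] makes the choice harmless modulo
    the relations. *)
Definition lift_l U (x : M U) : mor U Y := sval (cid (pE x)).
Definition lift_r U (y : N U) : mor U Y' := sval (cid (qE y)).

Lemma lift_lK U (x : M U) : p U (lift_l x) = x.
Proof. by rewrite /lift_l; case: cid. Qed.

Lemma lift_rK U (y : N U) : q U (lift_r y) = y.
Proof. by rewrite /lift_r; case: cid. Qed.

Definition gen_lift Z (g : day_gen M N Z) : mor Z (tens T Y Y') :=
  bmap (tens T) (lift_l (day_x g)) (lift_r (day_y g)) ∘ day_f g.

Definition seq_lift Z (s : seq (day_gen M N Z)) : mor Z (tens T Y Y') :=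
  \sum_(g <- s) gen_lift g.

(* [seq_lift] inverts the presentation map [y (Y ⊗ Y') -> day M N] defined below,
   modulo the relations. *)
Lemma seq_lift_rel Z (s t : seq (day_gen M N Z)) :
  day_rel s t -> in_rel (seq_lift s - seq_lift t).
Proof.
rewrite /seq_lift; elim=> {s t} //.
- by move=> s; rewrite subrr; exact: in_rel0.
- by move=> s t _ /in_relN; rewrite opprB.
- by move=> s t u _ h _ h'; have := in_relD h h'; rewrite addrA subrK.
- move=> s s' t t' _ h _ h'; have := in_relD h h'.
  by rewrite !big_cat /= opprD addrACA.
- by move=> s t; rewrite !big_cat /= [X in X - _]addrC subrr; exact: in_rel0.
- move=> U V y h; rewrite big_nil subr0 big_seq1; apply: in_rel_comp.
  by apply: in_rel_l; rewrite lift_lK.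
- move=> U V x x' y h; rewrite !big_cons !big_nil !addr0 /gen_lift /= -mcompDl -mcompBl.
  rewrite -bmapDl; apply/in_rel_comp/in_relB => //.
  by rewrite mod_funD !lift_lK.
- move=> U V x y y' h; rewrite !big_cons !big_nil !addr0 /gen_lift /= -mcompDl -mcompBl.
  rewrite -bmapDr; apply/in_rel_comp/in_relB => //.
  by rewrite mod_funD !lift_rK.
- move=> U V x y h h'; rewrite !big_cons !big_nil !addr0 /gen_lift /= -mcompDr subrr.
  exact: in_rel0.
- move=> U U' V V' a b x y h; rewrite !big_seq1 /gen_lift /= mcompA -mcompBl.
  rewrite -bmapC; apply/in_rel_comp/in_relB.
    rewrite lift_lK -[lift_l x ∘ a]/(res a (lift_l x : yoneda Y U)).
    by rewrite mod_fun_nat lift_lK.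
  rewrite lift_rK -[lift_r y ∘ b]/(res b (lift_r y : yoneda Y' V)).
  by rewrite mod_fun_nat lift_rK.
Qed.

Lemma day_pres_add Z (u v : mor Z (tens T Y Y')) :
  day_class [:: DayGen (p Y (idm Y)) (q Y' (idm Y')) (u + v)] =
  (day_class [:: DayGen (p Y (idm Y)) (q Y' (idm Y')) u] : day_grp M N Z) +
  day_class [:: DayGen (p Y (idm Y)) (q Y' (idm Y')) v].
Proof.
rewrite -[RHS]/(day_add _ _) day_addE.
by apply/day_classP; exact: day_addf.
Qed.

Lemma day_pres_nat Z W (h : mor W Z) (u : mor Z (tens T Y Y')) :
  day_class [:: DayGen (p Y (idm Y)) (q Y' (idm Y')) (u ∘ h)] =
  day_restr h (day_class [:: DayGen (p Y (idm Y)) (q Y' (idm Y')) u]).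
Proof. by rewrite day_restrE. Qed.

Definition day_pres : modMor (yoneda (tens T Y Y')) (day M N) :=
  @ModMor T (yoneda (tens T Y Y')) (day M N)
    (fun Z u => day_class [:: DayGen (p Y (idm Y)) (q Y' (idm Y')) u])
    day_pres_add (fun W Z h u => day_pres_nat h u).

(** By Yoneda, [p U a] and [q V b] are restrictions of the images of the identities, and the coend
    relation moves [a] and [b] into the third entry. *)
Lemma day_pres_gen Z (U V : T) (a : mor U Y) (b : mor V Y')
    (h : mor Z (tens T U V)) :
  day_pres Z (bmap (tens T) a b ∘ h) = day_class [:: DayGen (p U a) (q V b) h].
Proof.
by rewrite (yoneda_lemma p) (yoneda_lemma q); apply/day_classP/day_sym/day_res.
Qed.

Lemma day_presE Z (s : seq (day_gen M N Z)) :
  day_pres Z (seq_lift s) = day_class s.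
Proof.
rewrite /seq_lift; elim: s => [|[U V x y h] s IHs].
  by rewrite big_nil (mod_fun0 day_pres).
rewrite big_cons (mod_funD day_pres) {}IHs /gen_lift day_pres_gen lift_lK lift_rK.
exact: day_addE.
Qed.

Lemma day_pres_epi : mod_epi day_pres.
Proof. by move=> Z c; exists (seq_lift (day_repr c)); rewrite day_presE day_reprK. Qed.

Lemma day_pres_exact : mod_exact (yoneda_mor day_pres_rel) day_pres.
Proof.
have fp0 : p X f = 0 by apply/pX; exists (idm X); exact: mcompm1.
have fq0 : q X' f' = 0 by apply/qX; exists (idm X'); exact: mcompm1.
move=> Z u; split.
  move=> /day_classP /seq_lift_rel; rewrite /seq_lift big_seq1 big_nil subr0.
  rewrite /gen_lift /= => h.
  (* The chosen lifts and the identities have the same images under [p] and [q], so the lifted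
     generator differs from [u] by a relation. *)
  have /(in_rel_comp u) : in_rel (bmap (tens T) (lift_l (p Y (idm Y)))
      (lift_r (q Y' (idm Y'))) - bmap (tens T) (idm Y) (idm Y')).
    by apply: in_relB; rewrite ?lift_lK ?lift_rK.
  rewrite mcompBl bmap1 mcomp1m => /in_relN/(in_relD h).
  by rewrite opprB addrC subrK.
move=> [v <-] /=; rewrite -[LHS]/(day_pres Z (day_pres_rel ∘ v)).
(* The two summands become generators with an entry [p X f] or [q X' f'], both zero by exactness. *)
rewrite /day_pres_rel mcompDl -!mcompA (mod_funD day_pres) !day_pres_gen fp0 fq0.
have -> : day_class [:: DayGen (0 : M X) (q Y' (idm Y')) (pr1 ∘ v)] = 0 :> day M N Z.
  by apply/day_classP/day_zero.
rewrite add0r; exact: day_gen0r.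
Qed.

End DayFinPres.

Lemma fin_pres_day (T : ttCat) (M N : Mod T) :
  fin_pres M -> fin_pres N -> fin_pres (day M N).
Proof.
move=> [X [Y [f [p [pE pX]]]]] [X' [Y' [f' [q [qE qX]]]]].
exists (tens T X Y' ⊕ tens T Y X'), (tens T Y Y'), (day_pres_rel f f').
exists (day_pres p q); split; first exact: day_pres_epi.
exact: day_pres_exact.
Qed.

(** * The universal property of Day convolution: additive, balanced and natural families induce
    morphisms out of it *)

Section DayLift.
Context (T : ttCat) (M N P : Mod T).
Context (h : forall Z X Y : T, M X -> N Y -> mor Z (tens T X Y) -> P Z).
Hypothesis hDx : forall (Z X Y : T) (x x' : M X) (y : N Y) (f : mor Z (tens T X Y)),
  h (x + x') y f = h x y f + h x' y f.
Hypothesis hDy : forall (Z X Y : T) (x : M X) (y y' : N Y) (f : mor Z (tens T X Y)),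
  h x (y + y') f = h x y f + h x y' f.
Hypothesis hDf : forall (Z X Y : T) (x : M X) (y : N Y) (f f' : mor Z (tens T X Y)),
  h x y (f + f') = h x y f + h x y f'.
Hypothesis h_mid : forall (Z X X' Y Y' : T) (a : mor X' X) (b : mor Y' Y)
    (x : M X) (y : N Y) (f : mor Z (tens T X' Y')),
  h (res a x) (res b y) f = h x y (bmap (tens T) a b ∘ f).
Hypothesis h_res : forall (Z W X Y : T) (x : M X) (y : N Y)
    (f : mor Z (tens T X Y)) (k : mor W Z),
  h x y (f ∘ k) = res k (h x y f).

Definition day_sum Z (s : seq (day_gen M N Z)) : P Z :=
  \sum_(g <- s) h (day_x g) (day_y g) (day_f g).

Lemma day_sum_rel Z (s t : seq (day_gen M N Z)) :
  day_rel s t -> day_sum s = day_sum t.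
Proof.
rewrite /day_sum; elim=> {s t} //.
- by move=> s t u _ -> _ ->.
- by move=> s s' t t' _ e _ e'; rewrite !big_cat /= e e'.
- by move=> s t; rewrite !big_cat /= addrC.
- move=> X Y y f; rewrite !big_cons !big_nil addr0 /=.
  by apply: (addrI (h 0 y f)); rewrite -hDx !addr0.
- by move=> X Y x x' y f; rewrite !big_cons !big_nil !addr0 /= hDx.
- by move=> X Y x y y' f; rewrite !big_cons !big_nil !addr0 /= hDy.
- by move=> X Y x y f f'; rewrite !big_cons !big_nil !addr0 /= hDf.
- by move=> X X' Y Y' a b x y f; rewrite !big_cons !big_nil !addr0 /= h_mid.
Qed.

Definition day_lift_fun Z (c : day M N Z) : P Z := day_sum (day_repr c).

Lemma day_lift_funE Z (s : seq (day_gen M N Z)) :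
  day_lift_fun (day_class s) = day_sum s.
Proof. exact/day_sum_rel/day_repr_class. Qed.

Lemma day_lift_funD Z (c d : day M N Z) :
  day_lift_fun (c + d) = day_lift_fun c + day_lift_fun d.
Proof.
elim/day_ind: c => s; elim/day_ind: d => t.
rewrite -[X in day_lift_fun X]/(day_add _ _) day_addE !day_lift_funE.
by rewrite /day_sum big_cat.
Qed.

Lemma day_lift_fun_nat W Z (k : mor W Z) (c : day M N Z) :
  day_lift_fun (res k c) = res k (day_lift_fun c).
Proof.
elim/day_ind: c => s; rewrite -[X in day_lift_fun X]/(day_restr _ _) day_restrE.
rewrite !day_lift_funE /day_sum big_map.
elim: s => [|g s IHs]; first by rewrite !big_nil res0.
by rewrite !big_cons IHs res_add /= h_res.
Qed.

Definition day_lift : modMor (day M N) P :=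
  @ModMor T (day M N) P day_lift_fun day_lift_funD day_lift_fun_nat.

Lemma day_lift_gen (Z X Y : T) (x : M X) (y : N Y) (f : mor Z (tens T X Y)) :
  day_lift Z (day_class [:: DayGen x y f]) = h x y f.
Proof. by rewrite [LHS]day_lift_funE /day_sum big_cons big_nil addr0. Qed.

End DayLift.

(** Formal sums carry no signs, so induction on their length suffices. The map is a single additive
    one because [pull_day] applies this to a component of a morphism into a pulled-back module. *)
Lemma day_epi_gen (T : ttCat) (M N : Mod T) (G : abGrp) (Z : T)
    (p : G -> day M N Z) :
  (forall a b, p (a + b) = p a + p b) ->
  (forall (X Y : T) (x : M X) (y : N Y) (f : mor Z (tens T X Y)),
    exists a, p a = day_class [:: DayGen x y f]) ->
  forall c, exists a, p a = c.
Proof.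
move=> pD hg; elim/day_ind; elim=> [|[X Y x y f] s [a ea]].
  by exists 0; apply: (addrI (p 0)); rewrite -pD !addr0.
have [b eb] := hg X Y x y f; exists (b + a); rewrite pD ea eb.
exact: day_addE.
Qed.

(** * Properness of Serre ideals *)

(** The right unitor induces a surjection from [M] ⊗ 1 onto [M], whose source lies in [B] by the
    ideal property. *)
Lemma serre_ideal_unit (T : ttCat) (B : Mod T -> Prop) :
  is_serre_ideal B -> B (yoneda (tunit T)) -> forall M, fin_pres M -> B M.
Proof.
move=> [sB iB] B1 M fM.
pose h (Z X Y : T) (x : M X) (y : yoneda (tunit T) Y) (f : mor Z (tens T X Y)) : M Z :=
  res (trunit X ∘ (bmap (tens T) (idm X) y ∘ f)) x.
have hDx Z X Y x x' y f : @h Z X Y (x + x') y f = h Z X Y x y f + h Z X Y x' y f.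
  by rewrite /h res_add.
have hDy Z X Y x y y' f : @h Z X Y x (y + y') f = h Z X Y x y f + h Z X Y x y' f.
  by rewrite /h bmapDr mcompDl mcompDr res_Dl.
have hDf Z X Y x y f f' : @h Z X Y x y (f + f') = h Z X Y x y f + h Z X Y x y f'.
  by rewrite /h !mcompDr res_Dl.
have hm Z X X' Y Y' (a : mor X' X) (b : mor Y' Y) x y f :
    h Z X' Y' (res a x) (res b y) f = h Z X Y x y (bmap (tens T) a b ∘ f).
  rewrite /h -resC /= mcompA trunit_nat -mcompA !(mcompA (bmap _ _ _) (bmap _ _ _)).
  by rewrite -!bmapC !mcomp1m mcompm1.
have hr Z W X Y x y f (k : mor W Z) : h W X Y x y (f ∘ k) = res k (h Z X Y x y f).
  by rewrite /h -resC !mcompA.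
apply: (serre_quo sB (p := day_lift hDx hDy hDf hm hr)) (fM) (iB _ _ fM B1).
move=> Z x; exists (day_class [:: DayGen x (idm (tunit T) : yoneda _ _) (bwd (trunit Z))]).
by rewrite day_lift_gen /h bmap1 mcomp1m fwdK res1.
Qed.

Lemma proper_unit (T : ttCat) (B : Mod T -> Prop) :
  is_serre_ideal B -> is_proper B <-> ~ B (yoneda (tunit T)).
Proof.
move=> sB; split=> [[M [fM nM]] B1|n1].
  exact: nM (serre_ideal_unit sB B1 fM).
by exists (yoneda (tunit T)); split=> //; exact: fin_pres_yoneda.
Qed.

(** * Pullback of modules and of Serre ideals *)

Definition pull (C D : addCat) (F : functor C D) (M : Mod D) : Mod C :=
  @MkMod C (fun X => M (F X)) (fun X Y f => res (fmor F f))
    (fun X x => etrans (congr1 (fun u => res u x) (fmor1 F X)) (res1 x))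
    (fun X Y Z g f x =>
       etrans (congr1 (fun u => res u x) (fmorC F g f)) (resC _ _ x))
    (fun X Y f => res_add (fmor F f))
    (fun X Y f g x =>
       etrans (congr1 (fun u => res u x) (fmorD F f g)) (res_Dl _ _ x)).

Definition pull_mor (C D : addCat) (F : functor C D) (M N : Mod D)
    (p : modMor M N) : modMor (pull F M) (pull F N) :=
  @ModMor C (pull F M) (pull F N) (fun X => p (F X))
    (fun X => mod_funD p (X := F X)) (fun X Y f => mod_fun_nat p (fmor F f)).

Definition comp_mor (C : addCat) (L M N : Mod C) (q : modMor M N) (p : modMor L M) :
    modMor L N :=
  @ModMor C L N (fun X x => q X (p X x))
    (fun X x y => etrans (congr1 (q X) (mod_funD p x y)) (mod_funD q _ _))
    (fun X Y f x => etrans (congr1 (q X) (mod_fun_nat p f x)) (mod_fun_nat q f _)).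

(* An adjunction [F ⊣ G], given by its counit, with [F] oplax monoidal; the
   last field says that [F (GX ⊗ GY) -> FGX ⊗ FGY -> X ⊗ Y] exhibits
   [GX ⊗ GY] as a weak coreflection of [X ⊗ Y] along [F]. *)
Record monoidal_adj (S T : ttCat) (F : functor S T) (G : functor T S) := MonoidalAdj {
  counit : forall X : T, mor (F (G X)) X;
  counit_nat : forall (X Y : T) (f : mor X Y),
    f ∘ counit X = counit Y ∘ fmor F (fmor G f);
  counit_surj : forall (Z : S) (X : T) (u : mor (F Z) X),
    exists v : mor Z (G X), counit X ∘ fmor F v = u;
  counit_inj : forall (Z : S) (X : T) (v v' : mor Z (G X)),
    counit X ∘ fmor F v = counit X ∘ fmor F v' -> v = v';
  oplax : forall P Q : S, mor (F (tens S P Q)) (tens T (F P) (F Q));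
  oplax_nat : forall (P P' Q Q' : S) (a : mor P P') (b : mor Q Q'),
    bmap (tens T) (fmor F a) (fmor F b) ∘ oplax P Q =
    oplax P' Q' ∘ fmor F (bmap (tens S) a b);
  oplax_surj : forall (Z : S) (X Y : T) (f : mor (F Z) (tens T X Y)),
    exists f' : mor Z (tens S (G X) (G Y)),
      bmap (tens T) (counit X) (counit Y) ∘ oplax (G X) (G Y) ∘ fmor F f' = f }.

(** Finite presentation is imposed because ideals are encoded as classes of arbitrary modules. *)
Definition pull_ideal (C D : addCat) (F : functor C D) (B : Mod C -> Prop) :
    Mod D -> Prop :=
  fun M => fin_pres M /\ B (pull F M).

Section PullIdeal.
Context (S T : ttCat) (F : functor S T) (G : functor T S) (a : monoidal_adj F G).

Lemma pull_yoneda_add (X : T) (Z : S) (u v : yoneda (G X) Z) :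
  counit a X ∘ fmor F (u + v) = counit a X ∘ fmor F u + counit a X ∘ fmor F v.
Proof. by rewrite fmorD mcompDr. Qed.

Lemma pull_yoneda_nat (X : T) (W Z : S) (k : mor W Z) (u : yoneda (G X) Z) :
  counit a X ∘ fmor F (res k u) = res k (counit a X ∘ fmor F u : pull F (yoneda X) Z).
Proof. by rewrite /= fmorC mcompA. Qed.

(** The adjunction bijection Hom(Z, G X) ≅ Hom(F Z, X), which makes pullbacks of representables
    representable. *)
Definition pull_yoneda (X : T) : modMor (yoneda (G X)) (pull F (yoneda X)) :=
  @ModMor S (yoneda (G X)) (pull F (yoneda X)) (fun Z u => counit a X ∘ fmor F u)
    (@pull_yoneda_add X) (@pull_yoneda_nat X).

(** Pullback is exact, since exactness is objectwise, and [pull_yoneda] identifies the pulled-back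
    presentation with one by representables. *)
Lemma fin_pres_pull (M : Mod T) : fin_pres M -> fin_pres (pull F M).
Proof.
move=> [X [Y [f [p [pE pX]]]]].
exists (G X), (G Y), (fmor G f), (comp_mor (pull_mor F p) (pull_yoneda Y)); split.
  move=> Z y; have [u <-] := pE _ y; have [v <-] := counit_surj a u.
  by exists v.
move=> Z u; split=> /= [/pX[v /= e]|[v <-]].
  have [w ew] := counit_surj a v; exists w; apply: (counit_inj (m := a)).
  by rewrite fmorC mcompA -counit_nat -mcompA ew.
apply/pX; exists (counit a X ∘ fmor F v) => /=.
by rewrite mcompA counit_nat fmorC mcompA.
Qed.

(** The oplax structure of [F] induces a surjection from [day (pull F M) (pull F N)] onto
    [pull F (day M N)]. *)
Lemma pull_day (B : Mod S -> Prop) (M N : Mod T) : is_serre B ->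
  fin_pres M -> fin_pres N -> B (day (pull F M) (pull F N)) -> B (pull F (day M N)).
Proof.
move=> sB fM fN.
pose h (Z X Y : S) (x : pull F M X) (y : pull F N Y) (f : mor Z (tens S X Y)) :
  pull F (day M N) Z := day_class
    [:: @DayGen T M N (F Z) (F X) (F Y) x y (oplax a X Y ∘ fmor F f)].
have hDx Z X Y x x' y f : @h Z X Y (x + x') y f = h Z X Y x y f + h Z X Y x' y f.
  rewrite -[RHS]/(day_add _ _) day_addE; apply/day_classP; exact: day_addx.
have hDy Z X Y x y y' f : @h Z X Y x (y + y') f = h Z X Y x y f + h Z X Y x y' f.
  rewrite -[RHS]/(day_add _ _) day_addE; apply/day_classP; exact: day_addy.
have hDf Z X Y x y f f' : @h Z X Y x y (f + f') = h Z X Y x y f + h Z X Y x y f'.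
  rewrite /h fmorD mcompDr -[RHS]/(day_add _ _) day_addE; apply/day_classP; exact: day_addf.
have hm Z X X' Y Y' (k : mor X' X) (b : mor Y' Y) x y f :
    h Z X' Y' (res k x) (res b y) f = h Z X Y x y (bmap (tens S) k b ∘ f).
  by rewrite /h fmorC mcompA -oplax_nat -mcompA; apply/day_classP/day_res.
have hr Z W X Y x y f (k : mor W Z) : h W X Y x y (f ∘ k) = res k (h Z X Y x y f).
  by rewrite [RHS]day_restrE /h fmorC mcompA.
apply: (serre_quo sB (p := day_lift hDx hDy hDf hm hr)).
  move=> Z; apply: (day_epi_gen (p := day_lift hDx hDy hDf hm hr Z)).
    exact: (mod_funD (day_lift hDx hDy hDf hm hr)).
  (* The weak coreflection factors [f] through some [f'] into [G X] ⊗ [G Y]; the coend relation then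
     moves the counits onto [x] and [y]. *)
  move=> X Y x y f; have [f' e] := oplax_surj a f.
  exists (day_class [:: @DayGen S (pull F M) (pull F N) Z (G X) (G Y)
    (res (counit a X) x) (res (counit a Y) y) f']).
  rewrite day_lift_gen /h -e -mcompA; exact/day_classP/day_res.
exact: fin_pres_pull (fin_pres_day fM fN).
Qed.

Lemma pull_ideal_serre (B : Mod S -> Prop) :
  is_serre_ideal B -> is_serre_ideal (pull_ideal F B).
Proof.
move=> [sB iB]; split; last first.
  move=> M N fM [fN BN]; split; first exact: fin_pres_day.
  exact: (pull_day sB fM fN (iB _ _ (fin_pres_pull fM) BN)).
split=> [M []//||M N i iM fM [fN BN]|M N p pE fN [fM BM]|L M N i p iM ip pE fM [_ BL] [_ BN]].
(* The pullback of the zero representable vanishes, so it is a quotient of the zero representable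
   over [S], which lies in [B]. *)
- exists (yoneda (zob T)); split; first exact: fin_pres_yoneda.
  have z0 Z (u v : pull F (yoneda (zob T)) Z) : u = v by rewrite (zero_in u) (zero_in v).
  apply: (serre_quo sB (p := @ModMor S (yoneda (zob S)) (pull F (yoneda (zob T)))
    (fun _ _ => 0) (fun _ _ _ => z0 _ _ _) (fun _ _ _ _ => z0 _ _ _))) (serre_zob sB).
    by move=> Z u; exists 0; exact: z0.
  exact/fin_pres_pull/fin_pres_yoneda.
- split=> //; apply: (serre_sub sB (i := pull_mor F i)) BN; last exact: fin_pres_pull.
  by move=> Z; exact: iM.
- split=> //; apply: (serre_quo sB (p := pull_mor F p)) BM; last exact: fin_pres_pull.
  by move=> Z; exact: pE.
- split=> //; apply: (serre_ext sB (i := pull_mor F i) (p := pull_mor F p)) BL BN.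
  + by move=> Z; exact: iM.
  + by move=> Z; exact: ip.
  + by move=> Z; exact: pE.
  + exact: fin_pres_pull.
Qed.

Lemma pull_ideal_yoneda (B : Mod S -> Prop) (X : T) : is_serre B ->
  pull_ideal F B (yoneda X) <-> B (yoneda (G X)).
Proof.
move=> sB; split=> [[_]|BX].
  apply: (serre_sub sB (i := pull_yoneda X)); last exact: fin_pres_yoneda.
  by move=> Z u v; exact: counit_inj.
split; first exact: fin_pres_yoneda.
apply: (serre_quo sB (p := pull_yoneda X)) BX; last exact/fin_pres_pull/fin_pres_yoneda.
by move=> Z u; exact: counit_surj.
Qed.

End PullIdeal.

Lemma pull_ideal_mono (C D : addCat) (F : functor C D) (B B' : Mod C -> Prop) :
  (forall M, B M -> B' M) -> forall M, pull_ideal F B M -> pull_ideal F B' M.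
Proof. by move=> s M [fM BM]; split=> //; exact: s. Qed.

(** * Passage between ideals for [T] and for its trivial extension *)

Section TrivialExtensionAdjunctions.
Context (T : ttCat) (K : triCat) (A : ttAction T K).
Local Notation E := (trivial_extension A).

Definition ext_fst : functor E T := fstF T K.

Program Definition ext_in : functor T E :=
  @Functor T E (fun X => (X, zob K)) (fun _ _ f => (f, 0)) _ _ _.
Next Obligation. by move=> X; congr (_, _); rewrite zobP. Qed.
Next Obligation. by move=> *; congr (_, _); rewrite mcomp0m. Qed.
Next Obligation. by move=> *; congr (_, _); rewrite addr0. Qed.

(** A morphism P → (X, 0) amounts to its first component. The first component of a tensor product is
    by definition the tensor product in [T], so [oplax] is an identity. *)
Program Definition ext_fst_adj : monoidal_adj ext_fst ext_in :=
  @MonoidalAdj E T ext_fst ext_in (fun X => idm X) _ _ _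
    (fun P Q => idm (tens T P.1 Q.1)) _ _.
Next Obligation. by move=> *; rewrite /= mcomp1m mcompm1. Qed.
Next Obligation. by move=> Z X u; exists (u, 0); rewrite /= mcomp1m. Qed.
Next Obligation.
move=> Z X [u u'] [v v'] /=; rewrite !mcomp1m => ->.
by rewrite (zero_in u') (zero_in v').
Qed.
Next Obligation. by move=> *; rewrite /= mcomp1m mcompm1. Qed.
Next Obligation. by move=> Z X Y f; exists (f, 0); rewrite /= bmap1 !mcomp1m. Qed.

(** A morphism (X, 0) → P amounts to its first component. The second component of (X, 0) ⊗ (Y, 0) is
    a sum of two zero objects rather than [zob K] itself, so [oplax] is (id, 0). *)
Program Definition ext_in_adj : monoidal_adj ext_in ext_fst :=
  @MonoidalAdj T E ext_in ext_fst (fun P => (idm P.1, 0)) _ _ _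
    (fun X Y => (idm (tens T X Y), 0)) _ _.
Next Obligation.
move=> P Q f; apply: (@ext_mor_eq T K).
  by rewrite /= mcomp1m mcompm1.
by rewrite /= mcomp0m mcompm0.
Qed.
Next Obligation.
move=> Z P [u u']; exists u; apply: (@ext_mor_eq T K); rewrite /= ?mcomp1m //.
by rewrite [RHS]zero_out mcompm0.
Qed.
Next Obligation. by move=> Z P u v [] /=; rewrite !mcomp1m. Qed.
Next Obligation.
move=> *; apply: (@ext_mor_eq T K); rewrite /= ?mcomp1m ?mcompm1 //.
by rewrite mcompm0 mcomp0m.
Qed.
Next Obligation.
move=> Z P Q [u u']; exists u; apply: (@ext_mor_eq T K); rewrite /= ?bmap1 ?mcomp1m //.
by rewrite [RHS]zero_out mcompm0.
Qed.

Definition fst_ideal (B : Mod E -> Prop) : Mod T -> Prop := pull_ideal ext_fst B.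
Definition in_ideal (C : Mod T -> Prop) : Mod E -> Prop := pull_ideal ext_in C.

Lemma fst_ideal_serre B : is_serre_ideal B -> is_serre_ideal (fst_ideal B).
Proof. exact: (pull_ideal_serre ext_fst_adj). Qed.

Lemma in_ideal_serre C : is_serre_ideal C -> is_serre_ideal (in_ideal C).
Proof. exact: (pull_ideal_serre ext_in_adj). Qed.

Lemma fst_ideal_yoneda B X : is_serre_ideal B ->
  fst_ideal B (yoneda X) <-> B (yoneda (ext_in X)).
Proof. by move=> [sB _]; exact: (pull_ideal_yoneda ext_fst_adj). Qed.

Lemma in_ideal_yoneda C P : is_serre_ideal C ->
  in_ideal C (yoneda P) <-> C (yoneda (ext_fst P)).
Proof. by move=> [sC _]; exact: (pull_ideal_yoneda ext_in_adj). Qed.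

(** [ext_fst] after [ext_in] is the identity on objects and morphisms, so the double pullback has
    the same elements as [M], and the identity maps are surjections both ways. *)
Lemma fst_in_ideal C M : is_serre_ideal C -> fst_ideal (in_ideal C) M <-> C M.
Proof.
move=> [sC _]; pose M' := pull ext_in (pull ext_fst M).
split=> [[fM [_ CM]]|CM].
  exact: (serre_quo sC (p := @ModMor T M' M (fun _ x => x) (fun _ _ _ => erefl)
    (fun _ _ _ _ => erefl)) (fun X x => ex_intro _ x erefl) fM CM).
have fM := serre_fp sC CM.
have fM1 := fin_pres_pull ext_fst_adj fM.
do 2 split=> //.
exact: (serre_quo sC (p := @ModMor T M M' (fun _ x => x) (fun _ _ _ => erefl)
  (fun _ _ _ _ => erefl)) (fun X x => ex_intro _ x erefl)
  (fin_pres_pull ext_in_adj fM1) CM).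
Qed.

(* [M] surjects onto its [T]-part along the maps [res] of [(X, 0) -> (X, A)]. *)
Lemma in_fst_ideal B M : is_serre_ideal B -> B M -> in_ideal (fst_ideal B) M.
Proof.
move=> [sB _] BM; have fM := serre_fp sB BM.
have fM1 := fin_pres_pull ext_in_adj fM.
do 2 split=> //.
pose M' := pull ext_fst (pull ext_in M).
pose e P : M P -> M' P := res (counit ext_in_adj P).
have eN P Q (f : mor P Q) (x : M Q) : e P (res f x) = res f (e Q x).
  rewrite /e /= -!resC; congr (res _ _); exact: (counit_nat ext_in_adj f).
apply: (serre_quo sB (p := @ModMor E M M' e
  (fun P x y => res_add (counit ext_in_adj P) x y) eN)) BM.
  (* The preimage comes from the projection P → (P.1, 0); the composite (P.1, 0) → P → (P.1, 0) is
     the identity because [idm (zob K)] is zero. *)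
  move=> P y; exists (res ((idm P.1, 0) : mor P (P.1, zob K)) (y : M (P.1, zob K))).
  apply: etrans (res1 (y : M (P.1, zob K))); rewrite /= /e -resC.
  apply: (congr1 ((@res E M (P.1, zob K) (P.1, zob K))^~ y)).
  apply: (@ext_mor_eq T K); rewrite /= ?mcomp1m //.
  by rewrite mcomp0m zobP.
exact (fin_pres_pull ext_fst_adj fM1).
Qed.

(** Properness is tested on units, and [ext_in] sends the unit of [T] to the unit (1, 0). *)
Lemma fst_ideal_proper B : is_serre_ideal B -> is_proper B -> is_proper (fst_ideal B).
Proof.
move=> sB /(proper_unit sB) n1; apply/(proper_unit (fst_ideal_serre sB)).
by move=> /(fst_ideal_yoneda _ sB).
Qed.

Lemma in_ideal_proper C : is_serre_ideal C -> is_proper C -> is_proper (in_ideal C).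
Proof.
move=> sC /(proper_unit sC) n1; apply/(proper_unit (in_ideal_serre sC)).
by move=> /(in_ideal_yoneda _ sC).
Qed.

(** With f and g as above: if f B ⊆ C then B ⊆ g (f B) ⊆ g C, so g C ⊆ B by maximality and C = f (g
    C) ⊆ f B. *)
Lemma fst_ideal_maximal B :
  is_maximal_serre_ideal B -> is_maximal_serre_ideal (fst_ideal B).
Proof.
move=> [sB pB mB]; split=> [||C sC pC BC M CM]; first exact: fst_ideal_serre.
  exact: fst_ideal_proper.
have sub : forall N, in_ideal C N -> B N.
  apply: mB; [exact: in_ideal_serre|exact: in_ideal_proper|move=> N BN].
  exact: pull_ideal_mono BC _ (in_fst_ideal sB BN).
exact: pull_ideal_mono sub _ (proj2 (fst_in_ideal M sC) CM).
Qed.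

(** If g C ⊆ B then C = f (g C) ⊆ f B, so f B ⊆ C by maximality and B ⊆ g (f B) ⊆ g C. *)
Lemma in_ideal_maximal C :
  is_maximal_serre_ideal C -> is_maximal_serre_ideal (in_ideal C).
Proof.
move=> [sC pC mC]; split=> [||B sB pB CB M BM]; first exact: in_ideal_serre.
  exact: in_ideal_proper.
have sub : forall N, fst_ideal B N -> C N.
  apply: mC; [exact: fst_ideal_serre|exact: fst_ideal_proper|move=> N CN].
  exact: pull_ideal_mono CB _ (proj2 (fst_in_ideal N sC) CN).
exact: pull_ideal_mono sub _ (in_fst_ideal sB BM).
Qed.

Definition fst_spch (B : Spch E) : Spch T :=
  MkSpch (fst_ideal_maximal (spch_maximal B)).
Definition in_spch (C : Spch T) : Spch E :=
  MkSpch (in_ideal_maximal (spch_maximal C)).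

End TrivialExtensionAdjunctions.

(** * Points of the spectrum, continuity and the homeomorphism *)

Lemma spch_serre (T : ttCat) (B : Spch T) : is_serre_ideal B.
Proof. by case: (spch_maximal B). Qed.

Lemma spch_ext (T : ttCat) (B C : Spch T) : (forall M, B M <-> C M) -> B = C.
Proof.
case: B C => [B mB] [C mC] /= e.
have eBC : B = C by apply/funext => M; exact/propext.
by case: _ / eBC mC e => mC _; congr MkSpch; exact: Prop_irrelevance.
Qed.

Local Open Scope classical_set_scope.

(** The preimage of the complement of [supph X] is the complement of [supph (F X)], and these
    complements generate the open sets under unions. *)
Lemma spch_continuous (S T : ttCat) (f : Spch S -> Spch T) (F : T -> S) :
  (forall B X, f B (yoneda X) <-> B (yoneda (F X))) -> continuous f.
Proof.
move=> fF; apply/continuousP => _ [D ->]; exists (F @` D).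
apply/seteqP; split=> B.
  move=> [X DX /supphC/fF BX]; exists (F X); first by exists X.
  exact/supphC.
move=> [_ [X DX <-] /supphC/fF fX].
by exists X.
Qed.

Theorem proposition4p5 (T : ttCat) (K : triCat) (A : ttAction T K) :
  homeomorphic (Spch (trivial_extension A)) (Spch T).
Proof.
exists (@fst_spch T K A), (@in_spch T K A); split.
- move=> B; apply: spch_ext => M; have sB := spch_serre B.
  have [_ pB mB] := spch_maximal B; split; last exact: in_fst_ideal.
  (* B ⊆ g (f B) is an inclusion into a proper Serre ideal, so maximality of [B] gives the
     converse. *)
  apply: mB => [||N]; last exact: in_fst_ideal.
    exact/in_ideal_serre/fst_ideal_serre.
  exact: in_ideal_proper (fst_ideal_serre sB) (fst_ideal_proper sB pB).
- by move=> C; apply: spch_ext => M; exact: fst_in_ideal (spch_serre C).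
- apply: (@spch_continuous _ _ _ (ext_in A)) => B X.
  exact: fst_ideal_yoneda (spch_serre B).
- apply: (@spch_continuous _ _ _ (ext_fst A)) => C P.
  exact: in_ideal_yoneda (spch_serre C).
Qed.
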